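(* Let $1\leq d\leq r$ and $n\geq1$ be integers and let $C\in\mathbb{R}^{dn\times dn}$ be real symmetric positive semidefinite with $d\times d$ blocks $C_{ij}$. Let $X_1,\dots,X_n\in\mathbb{R}^{d\times nd}$ be an optimal solution of \[ \max_{\substack{X_iX_i^T=I_{d\times d},\ X_i\in\mathbb{R}^{d\times nd}}}\ \sum_{i=1}^n\sum_{j=1}^n\operatorname{tr}\left(C_{ij}^TX_iX_j^T\right), \] let $R\in\mathbb{R}^{nd\times r}$ have i.i.d. real $\mathcal{N}(0,\frac1r)$ entries, and let $V_i=\mathcal{P}_{(d,r)}(X_iR)\in\mathcal{O}_{(d,r)}$. Then \[ \mathbb{E} \left[ \sum_{i=1}^n\sum_{j=1}^n\operatorname{tr}\left(C_{ij}^TV_iV_j^T\right) \right] \geq \alpha_{\mathbb{R}}(d,r)^2 \max_{O_1,\dots,O_n \in \mathcal{O}_{(d,r)}} \sum_{i=1}^n\sum_{j=1}^n\operatorname{tr}\left(C_{ij}^TO_iO_j^T\right). \]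
   Context: $\mathcal{O}_{(d,r)}=\{O\in\mathbb{R}^{d\times r}: OO^T=I_{d\times d}\}$ is the Stiefel manifold. For $X\in\mathbb{R}^{d\times r}$, $\mathcal{P}_{(d,r)}(X)=\operatorname{argmin}_{Z\in\mathcal{O}_{(d,r)}}\|Z-X\|_F$ (if $X=U[\Sigma\ 0]V^T$ is an SVD, this is $U[I_{d\times d}\ 0]V^T$). For $G\in\mathbb{R}^{d\times r}$ with i.i.d. real $\mathcal{N}(0,\frac1r)$ entries, $\alpha_{\mathbb{R}}(d,r)=\mathbb{E}\left[\frac1d\sum_{j=1}^d\sigma_j(G)\right]$, where $\sigma_j$ is the $j$-th singular value. *)

(* Defs.v *)
From HB Require Import structures.
From mathcomp Require Import all_boot all_order all_algebra.
From mathcomp Require Import all_classical all_reals all_analysis.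
From mathcomp Require Import normal_distribution.

Set Implicit Arguments.
Unset Strict Implicit.
Unset Printing Implicit Defensive.

Import Order.TTheory GRing.Theory Num.Theory.
Local Open Scope classical_set_scope.
Local Open Scope ring_scope.

Section Defs.
Variable R : realType.

Lemma bidx_proof (n d : nat) (i : 'I_n) (a : 'I_d) : (i * d + a < n * d)%N.
Proof.
case: i a => i hi [a ha] /=.
have : (i.+1 * d <= n * d)%N by rewrite leq_mul2r hi orbT.
rewrite mulSn => h; apply: leq_trans h; rewrite addnC ltn_add2r //.
Qed.

Definition bidx (n d : nat) (i : 'I_n) (a : 'I_d) : 'I_(n * d) :=
  Ordinal (bidx_proof i a).

Definition block (n d : nat) (C : 'M[R]_(n * d)) (i j : 'I_n) : 'M[R]_d :=
  \matrix_(a < d, b < d) C (bidx i a) (bidx j b).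

Definition psd (N : nat) (C : 'M[R]_N) : Prop :=
  C^T = C /\ forall v : 'cV[R]_N, 0 <= (v^T *m C *m v) 0 0.

Definition stiefel (d m : nat) (O : 'M[R]_(d, m)) : Prop := O *m O^T = 1%:M.

Definition obj (n d m : nat) (C : 'M[R]_(n * d)) (V : 'I_n -> 'M[R]_(d, m)) : R :=
  \sum_(i < n) \sum_(j < n) \tr ((block C i j)^T *m V i *m (V j)^T).

Definition frob (p q : nat) (A : 'M[R]_(p, q)) : R :=
  Num.sqrt (\sum_(i < p) \sum_(j < q) A i j ^+ 2).

Definition polar (d m : nat) (X : 'M[R]_(d, m)) : 'M[R]_(d, m) :=
  xget 0 [set Z | stiefel Z /\
                  forall Z', stiefel Z' -> frob (Z - X) <= frob (Z' - X)].

(* singular values sigma_1..sigma_d of G in R^{d x m}: square roots of the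
   eigenvalues (with multiplicity) of G G^T, i.e. of the roots of its
   characteristic polynomial *)
Definition singvals (d m : nat) (G : 'M[R]_(d, m)) : seq R :=
  map Num.sqrt (xget [::] [set s : seq R |
     char_poly (G *m G^T) = \prod_(x <- s) ('X - x%:P)]).

Definition optimal (n d : nat) (C : 'M[R]_(n * d))
    (X : 'I_n -> 'M[R]_(d, n * d)) : Prop :=
  (forall i, stiefel (X i)) /\
  forall Y : 'I_n -> 'M[R]_(d, n * d),
    (forall i, stiefel (Y i)) -> obj C Y <= obj C X.

Definition iid_gaussian (dsp : measure_display) (T : measurableType dsp)
    (P : probability T R) (p q : nat) (M : T -> 'M[R]_(p, q)) (v : R) : Prop :=
  [/\ forall i j, measurable_fun setT (fun w => M w i j),
      forall i j (A : set R), measurable A ->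
        P ((fun w => M w i j) @^-1` A) = normal_prob 0 (Num.sqrt v) A
    & forall A : 'I_p -> 'I_q -> set R, (forall i j, measurable (A i j)) ->
        P [set w | forall i j, A i j (M w i j)] =
        (\big[*%E/1%E]_(k : 'I_p * 'I_q)
            P ((fun w => M w k.1 k.2) @^-1` A k.1 k.2))%E].

Definition alphaE (dsp : measure_display) (T : measurableType dsp)
    (P : probability T R) (d m : nat) (G : T -> 'M[R]_(d, m)) : \bar R :=
  (\int[P]_w ((d%:R)^-1 * \sum_(s <- singvals (G w)) s)%:E)%E.

End Defs.

(* Main.v *)
(* With G = S V the polar decomposition, the objective is a positive semidefinite form, so
   obj V >= 2 c <V, X R> - c^2 obj (X R) for every c.  The Gaussian law is invariant under
   orthogonal maps, so one may assume that X_i selects the first d rows of R; sign changes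
   and transpositions of rows then give E [V_i R^T] = alpha X_i, while E [R R^T] = m I with
   m <= 1.  For c = alpha the expectation of the lower bound is at least alpha^2 obj X, and
   obj X dominates obj O for every feasible O, since the square root of the Gram matrix of
   (O_i) has the same Gram matrix and is feasible in dimension n d.

   The polar factor is the limit of the Newton-Schulz iteration, which makes it measurable;
   rotation invariance is reduced to Givens rotations of two independent entries. *)
Require Import Defs.
From HB Require Import structures.
From mathcomp Require Import all_boot all_order all_algebra.
From mathcomp Require Import all_classical all_reals all_analysis.
From mathcomp Require Import normal_distribution measurable_realfun complex perm.
From mathcomp Require Import ring lra.
Set Implicit Arguments.
Unset Strict Implicit.
Unset Printing Implicit Defensive.
Import Order.TTheory GRing.Theory Num.Theory numFieldNormedType.Exports.
Local Open Scope classical_set_scope.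
Local Open Scope ring_scope.

(** * Functional calculus of real symmetric matrices *)

(** [polar] is a chosen minimizer, so nothing is known about its measurability where [X_i R] is rank
    deficient, and the integrand on the left inherits this. Expectations are therefore computed with
    [polar_ns], a limit of measurable maps that agrees with [polar] off a null set, and the last
    comparison uses a monotonicity of the integral that asks for no measurability.

    The constant alpha enters through the identity that the trace of [polar_ns G *m G^T] is the sum
    of the singular values of [G]. The tangent bound at [c] has expectation (2 c alpha - c^2 m) obj
    X; at c = alpha this is alpha^2 (2 - m) obj X, so an upper bound on the second moment is the
    right direction.

    No density on matrix space appears: a law is determined by its values on boxes of entries, and
    independence is exploited by resampling chosen entries from a second copy on a product space. *)

Lemma intertwine (K : comUnitRingType) n (Vb Vt V Vc D : 'M[K]_n) :
  Vb *m Vt = 1%:M -> V *m Vc = 1%:M ->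
  Vt *m D *m Vb = Vc *m D *m V <-> Vb *m Vc *m D = D *m (Vb *m Vc).
Proof.
move=> e1 e2; split => [/(congr1 (fun M => Vb *m M *m Vc))|/(congr1 (fun M => Vt *m M *m V))].
  by rewrite !mulmxA e1 mul1mx -[_ *m V *m Vc]mulmxA e2 mulmx1 => ->.
rewrite !mulmxA (mulmx1C e1) mul1mx => ->.
by rewrite -[_ *m Vc *m V]mulmxA (mulmx1C e2) mulmx1.
Qed.

(** Commuting with [diag_mx d] forces [Q a b = 0] unless the entries [a] and [b] of [d] agree, a
    condition that survives applying a function to [d]. *)
Lemma comm_diag_mx (K : idomainType) n (Q : 'M[K]_n) (d d' : 'rV[K]_n) :
  (forall i j, d 0 i = d 0 j -> d' 0 i = d' 0 j) ->
  Q *m diag_mx d = diag_mx d *m Q -> Q *m diag_mx d' = diag_mx d' *m Q.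
Proof.
move=> dd' /matrixP e; apply/matrixP => a b; have := e a b.
rewrite !mul_mx_diag !mul_diag_mx !mxE.
have [->|Q0] := eqVneq (Q a b) 0; first by rewrite !mul0r !mulr0.
by rewrite mulrC => /(mulIf Q0)/dd' ->; rewrite mulrC.
Qed.

Lemma char_poly_conj (K : comUnitRingType) n (X Y D : 'M[K]_n) :
  X *m Y = 1%:M -> char_poly (X *m D *m Y) = char_poly D.
Proof.
move=> XY; rewrite /char_poly.
have -> : char_poly_mx (X *m D *m Y) =
    map_mx polyC X *m char_poly_mx D *m map_mx polyC Y.
  rewrite /char_poly_mx mulmxBr mulmxBl !map_mxM; congr (_ - _).
  by rewrite mul_mx_scalar -scalemxAl -map_mxM XY map_mx1 scalemx1.
by rewrite !det_mulmx mulrAC -det_mulmx -map_mxM XY map_mx1 det1 mul1r.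
Qed.

Lemma mulmx_conj (K : pzRingType) n (Vc V D E : 'M[K]_n) :
  V *m Vc = 1%:M -> (Vc *m D *m V) *m (Vc *m E *m V) = Vc *m (D *m E) *m V.
Proof. by move=> e; rewrite !mulmxA -(mulmxA _ V Vc) e mulmx1. Qed.

Section SymmetricMatrices.
Variables (F : rcfType) (n : nat).
Local Notation toC := (complex.real_complex F).
Local Notation CF := (complex.complex F).
Local Notation "M ^ct" := (map_mx Num.conj M^T) (at level 30).
Implicit Types A : 'M[F]_n.

(* [W] resolves the identity into positive matrices of trace 1; they need not be
   projectors, but [f |-> \sum_i f (l i) *: W i] is multiplicative. *)
Definition spectral_data (A : 'M[F]_n) (l : 'I_n -> F) (W : 'I_n -> 'M[F]_n) : Prop :=
    [/\ char_poly A = \prod_i ('X - (l i)%:P),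
        forall i, (W i)^T = W i /\ forall v : 'cV_n, 0 <= (v^T *m W i *m v) 0 0,
        forall i, \tr (W i) = 1,
        \sum_i W i = 1%:M /\ A = \sum_i l i *: W i &
        forall f g : F -> F,
          (\sum_i f (l i) *: W i) *m (\sum_i g (l i) *: W i) =
          \sum_i (f (l i) * g (l i)) *: W i].

Lemma toC_mx_inj m p : injective (@map_mx _ _ toC m p).
Proof. by move=> A B /matrixP h; apply/matrixP => i j; have := h i j; rewrite !mxE => -[]. Qed.

(** A real symmetric matrix is Hermitian, so its eigenvalues are real; the diagonalizing unitary [V]
    may still be complex. *)
Lemma sym_spectral A : A^T = A ->
  exists (l : 'I_n -> F) (V : 'M[CF]_n),
    V *m V ^ct = 1%:M /\
    map_mx toC A = V ^ct *m diag_mx (\row_i toC (l i)) *m V.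
Proof.
move=> sA.
have hA : (map_mx toC A) \is sesquilinear.hermsymmx.
  apply: spectral.realsym_hermsym.
    apply/is_hermitianmxP; rewrite expr0 scale1r map_mx_id //.
    by rewrite -{1}sA; apply/matrixP => i j; rewrite !mxE.
  by apply/mxOverP => i j; rewrite mxE; apply/complex.complex_realP; exists (A i j).
have := spectral.hermitian_spectral_diag_real hA.
move/spectral.hermitian_normalmx/spectral.orthomx_spectralP: hA.
have := spectral.spectral_unitarymx (map_mx toC A).
set V := spectral.spectralmx _; set D := spectral.spectral_diag _ => uV eA rD.
have iV := spectral.invmx_unitary uV; rewrite iV in eA.
exists (fun i => complex.Re (D 0 i)), V; split; first exact/spectral.unitarymxP.
rewrite [LHS]eA; suff -> : \row_i toC (complex.Re (D 0 i)) = D by [].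
apply/rowP => i; rewrite mxE complex.RRe_real //; exact: (mxOverP rD).
Qed.

(** [W i] is the real part of the rank-one projector on the i-th eigenvector. For a complex
    eigenvector this is not a projector, yet any f(A) formed with the complex projectors is real, so
    taking real parts leaves it unchanged and multiplicativity is inherited. *)
Lemma sym_functional_calculus A : A^T = A -> exists l W, spectral_data A l W.
Proof.
move=> sA; have [l [V [uV eA]]] := sym_spectral sA.
have uV' : V ^ct *m V = 1%:M by exact: mulmx1C.
pose Wc i := (row i V) ^ct *m row i V.
pose W i := map_mx (@complex.Re F) (Wc i).
pose Phi (f : F -> F) := V ^ct *m diag_mx (\row_i toC (f (l i))) *m V.
have PhiE f : Phi f = \sum_i toC (f (l i)) *: Wc i.
  apply/matrixP => a b; rewrite !mxE summxE; apply: eq_bigr => i _.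
  rewrite !mxE big_ord1 !mxE (bigD1 i) //= !mxE eqxx mulr1n big1 ?addr0; last first.
    by move=> j ji; rewrite !mxE (negbTE ji) mulr0n mulr0.
  by rewrite mulrCA mulrA.
have conjPhi f : map_mx Num.conj (Phi f) = Phi f.
  (* V conj V^* commutes with the spectrum of A, hence with f of it *)
  pose Q := map_mx Num.conj V *m V ^ct.
  have conjV : map_mx Num.conj (V ^ct) = V^T.
    by apply/matrixP => a b; rewrite !mxE conjCK.
  have conjD h : map_mx Num.conj (diag_mx (\row_i toC (h (l i)))) =
      diag_mx (\row_i toC (h (l i))).
    apply/matrixP => a b; rewrite !mxE rmorphMn /=; congr (_ *+ _).
    by rewrite conj_Creal //; apply/complex.complex_realP; exists (h (l a)).
  have cV : map_mx Num.conj V *m V^T = 1%:M.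
    have := congr1 (map_mx Num.conj) uV; rewrite map_mxM conjV => ->.
    by rewrite map_mx1.
  (* Conjugation replaces the eigenbasis by its conjugate, so [Phi h] is real exactly when the
     change of basis [Q] commutes with the diagonal. This is known for [h = id], where [Phi id] is
     the real matrix [A]. *)
  have QD h : map_mx Num.conj (Phi h) = Phi h <->
      Q *m diag_mx (\row_i toC (h (l i))) = diag_mx (\row_i toC (h (l i))) *m Q.
    by rewrite /Phi !map_mxM conjV conjD; exact: intertwine.
  apply/QD.
  have /QD : map_mx Num.conj (Phi id) = Phi id.
    rewrite -[Phi id]eA; apply/matrixP => a b; rewrite !mxE.
    by rewrite conj_Creal //; apply/complex.complex_realP; exists (A a b).
  by apply: comm_diag_mx => i j; rewrite !mxE => -[->].
have PhiR f : Phi f = map_mx toC (\sum_i f (l i) *: W i).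
  have := conjPhi f; rewrite PhiE => /matrixP h; apply/matrixP => a b.
  have := h a b; rewrite [in LHS]mxE => /eqP; rewrite -CrealE => /complex.complex_realP[x e].
  rewrite e mxE; congr (toC _); rewrite -[x]/(complex.Re (toC x)) -e.
  rewrite !summxE raddf_sum; apply: eq_bigr => i _; rewrite !mxE.
  case: (\sum_j _ * _) => u w /=; simpc; by [].
have WE i a b : W i a b = complex.Re ((V i a)^* * V i b).
  by rewrite !mxE big_ord1 !mxE.
exists l, W; split.
- apply: (map_poly_inj toC); rewrite map_char_poly eA char_poly_conj //.
  rewrite char_poly_trig ?diag_mx_is_trig // rmorph_prod; apply: eq_bigr => i _.
  by rewrite !mxE eqxx mulr1n rmorphB /= map_polyX map_polyC.
- move=> i; split.
    apply/matrixP => a b; rewrite mxE !WE.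
    case: (V i a) (V i b) => [u w] [u' w'] /=; ring.
  move=> v; pose p := \row_a complex.Re (V i a); pose q := \row_a complex.Im (V i a).
  (* The real part of a Hermitian rank-one matrix splits into the squares of the real and imaginary
     parts of the vector. *)
  have -> : W i = p^T *m p + q^T *m q.
    apply/matrixP => a b; rewrite WE !mxE !big_ord1 !mxE.
    by case: (V i a) (V i b) => [u w] [u' w'] /=; rewrite mulNr opprK.
  rewrite mulmxDr mulmxDl !mulmxA -!trmx_mul -!mulmxA mxE !mxE !big_ord1.
  by rewrite ![_^T 0 0]mxE -!expr2 addr_ge0 // sqr_ge0.
- move=> i; rewrite /mxtrace.
  have /matrixP/(_ i i) := uV; rewrite !mxE eqxx => /(congr1 (@complex.Re F)) /= <-.
  rewrite raddf_sum; apply: eq_bigr => a _; rewrite WE !mxE mulrC; by [].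
- split; last by apply: toC_mx_inj; rewrite -[RHS](PhiR id).
  apply: toC_mx_inj.
  have := PhiR (fun=> 1); under eq_bigr do rewrite scale1r. move=> <-.
  rewrite /Phi; have -> : \row__ toC 1 = const_mx 1 :> 'rV_n by apply/rowP => i; rewrite !mxE.
  by rewrite diag_const_mx mulmx1 uV' map_mx1.
- move=> f g; apply: toC_mx_inj; rewrite map_mxM -!PhiR -(PhiR (fun x => f x * g x)).
  set D := fun h : F -> F => diag_mx (\row_i toC (h (l i))).
  have DM : D (fun x => f x * g x) = D f *m D g.
    by rewrite /D mulmx_diag; congr diag_mx; apply/rowP => i; rewrite !mxE rmorphM.
  rewrite -[LHS]/((V ^ct *m D f *m V) *m (V ^ct *m D g *m V)).
  rewrite -[RHS]/(V ^ct *m D (fun x => f x * g x) *m V) DM.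
  exact: mulmx_conj.
Qed.
End SymmetricMatrices.

Section SpectralData.
Variables (F : rcfType) (n : nat).
Implicit Types (A : 'M[F]_n) (l : 'I_n -> F) (W : 'I_n -> 'M[F]_n).

Definition mxfun l W (f : F -> F) : 'M[F]_n := \sum_i f (l i) *: W i.

Lemma quad_gram m p (X : 'M[F]_(m, p)) (v : 'cV[F]_m) :
  (v^T *m (X *m X^T) *m v) 0 0 = \sum_j (X^T *m v) j 0 ^+ 2.
Proof.
rewrite !mulmxA -{1}[X]trmxK -trmx_mul -mulmxA mxE.
by apply: eq_bigr => j _; rewrite mxE expr2.
Qed.

Lemma sum_sqr_eq0 m (v : 'cV[F]_m) : \sum_j v j 0 ^+ 2 = 0 -> v = 0.
Proof.
move/eqP; rewrite psumr_eq0 => [/allP h|i _]; last exact: sqr_ge0.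
apply/colP => j; rewrite mxE; apply/eqP; rewrite -sqrf_eq0.
by apply: (implyP (h j _)); rewrite ?mem_index_enum.
Qed.

(** For an eigenvector v, a |v|^2 = |G^T v|^2. *)
Lemma gram_eigen_ge0 m (G : 'M[F]_(n, m)) (a : F) :
  root (char_poly (G *m G^T)) a -> 0 <= a.
Proof.
rewrite -eigenvalue_root_char => /eigenvalueP[v vA v0].
have e : a * (\sum_j v^T j 0 ^+ 2) = \sum_j (G^T *m v^T) j 0 ^+ 2.
  rewrite -quad_gram trmxK vA -scalemxAl mxE; congr (_ * _).
  by rewrite mxE; apply: eq_bigr => j _; rewrite mxE expr2.
have s0 : 0 < \sum_j v^T j 0 ^+ 2.
  rewrite lt_neqAle sumr_ge0 ?andbT; last by move=> *; exact: sqr_ge0.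
  apply: contra_neq v0 => /esym/sum_sqr_eq0 /(congr1 trmx).
  by rewrite trmxK trmx0.
rewrite -(pmulr_lge0 _ s0) e; apply: sumr_ge0 => *; exact: sqr_ge0.
Qed.

Variables (A : 'M[F]_n) (l : 'I_n -> F) (W : 'I_n -> 'M[F]_n).
Hypothesis sd : spectral_data A l W.
Local Notation Phi := (mxfun l W).

Lemma mxfunM f g : Phi f *m Phi g = Phi (fun x => f x * g x).
Proof. by have [_ _ _ _ ->] := sd. Qed.

Lemma mxfun_id : Phi id = A.
Proof. by have [_ _ _ [_ ->] _] := sd. Qed.

Lemma mxfun1 : Phi (fun=> 1) = 1%:M.
Proof.
by have [_ _ _ [<- _] _] := sd; apply: eq_bigr => i _; rewrite scale1r.
Qed.

Lemma eq_mxfun f g : (forall i, f (l i) = g (l i)) -> Phi f = Phi g.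
Proof. by move=> fg; apply: eq_bigr => i _; rewrite fg. Qed.

Lemma mxfun_tr f : (Phi f)^T = Phi f.
Proof.
have [_ sW _ _ _] := sd; rewrite /mxfun raddf_sum; apply: eq_bigr => i _.
by rewrite /= linearZ /= (sW i).1.
Qed.

Lemma mxtrace_mxfun f : \tr (Phi f) = \sum_i f (l i).
Proof.
have [_ _ tW _ _] := sd; rewrite /mxfun raddf_sum; apply: eq_bigr => i _.
by rewrite /= mxtraceZ tW mulr1.
Qed.

Lemma quad_mxfun f (v : 'cV_n) :
  (v^T *m Phi f *m v) 0 0 = \sum_i f (l i) * (v^T *m W i *m v) 0 0.
Proof.
rewrite /mxfun mulmx_sumr mulmx_suml summxE; apply: eq_bigr => i _.
by rewrite -scalemxAr -scalemxAl mxE.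
Qed.

Lemma quad_spectral_ge0 i (v : 'cV_n) : 0 <= (v^T *m W i *m v) 0 0.
Proof. by have [_ sW _ _ _] := sd; exact: (sW i).2. Qed.

(** If the form vanished, so would each term v^T W_i v; these add up to |v|^2 because the [W i] sum
    to the identity. *)
Lemma quad_mxfun_gt0 f (v : 'cV_n) : (forall i, 0 < f (l i)) -> v != 0 ->
  0 < (v^T *m Phi f *m v) 0 0.
Proof.
move=> f0 v0; rewrite quad_mxfun lt_neqAle sumr_ge0 ?andbT; last first.
  by move=> i _; rewrite mulr_ge0 ?quad_spectral_ge0 // ltW.
apply: contra_neq v0 => /esym/eqP; rewrite psumr_eq0 => [/allP h|i _]; last first.
  by rewrite mulr_ge0 ?quad_spectral_ge0 // ltW.
apply: sum_sqr_eq0.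
transitivity ((v^T *m Phi (fun=> 1) *m v) 0 0).
  by rewrite mxfun1 mulmx1 mxE; apply: eq_bigr => j _; rewrite !mxE expr2.
rewrite quad_mxfun big1 // => i _; rewrite mul1r; apply/eqP.
have := h i; rewrite mem_index_enum => /(_ isT).
by rewrite mulf_eq0 gt_eqF.
Qed.

Lemma char_poly_root_spectral i : root (char_poly A) (l i).
Proof.
have [-> _ _ _ _] := sd.
by rewrite /root horner_prod (bigD1 i) //= hornerXsubC subrr mul0r.
Qed.

Lemma det_spectral : \det A = \prod_i l i.
Proof.
have [cA _ _ _ _] := sd; have := char_poly_det A.
rewrite cA -horner_coef0 horner_prod.
under eq_bigr do rewrite hornerXsubC sub0r -mulN1r.
have u : (-1 : F) ^+ n \is a GRing.unit by rewrite unitrX // unitrN1.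
by rewrite big_split /= prodr_const card_ord => /(mulrI u).
Qed.
End SpectralData.

(** * The polar factor *)

Section NewtonSchulz.
Variable R : realType.

(** On each singular value this acts as y -> (3 y - y^3) / 2, which has 1 as a superattracting fixed
    point and 0 as a fixed point. *)
Definition ns_step d m (Y : 'M[R]_(d, m)) : 'M[R]_(d, m) :=
  (3 / 2) *: Y - 2^-1 *: (Y *m Y^T *m Y).

(** Dividing by 1 plus the squared Frobenius norm brings all singular values into [0, 1], inside the
    basin of 1 apart from 0, and is harmless at [G = 0]. *)
Definition ns_iter d m (G : 'M[R]_(d, m)) (k : nat) : 'M[R]_(d, m) :=
  iter k (@ns_step d m) ((1 + \tr (G *m G^T))^-1 *: G).

(* The limit exists for every [G], also when [G] is rank deficient. *)
Definition polar_ns d m (G : 'M[R]_(d, m)) : 'M[R]_(d, m) :=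
  \matrix_(i, j) limn (fun k => ns_iter G k i j).

(** The coefficient multiplying [G] in the k-th iterate on the eigenspace of [G *m G^T] with
    eigenvalue [x]. *)
Definition ns_scalar (c x : R) (k : nat) : R :=
  iter k (fun y => 3 / 2 * y - 2^-1 * (y ^+ 3 * x)) c.

(** The error e = 1 - sqrt(x) y satisfies e' = e^2 (3 - e) / 2. Since e starts in [0, 1), it
    contracts at least by the factor q = e_0 (3 - e_0) / 2 < 1. *)
Lemma ns_scalar_cvg (c x : R) : 0 < c -> 0 < x -> c ^+ 2 * x <= 1 ->
  ns_scalar c x @ \oo --> (Num.sqrt x)^-1.
Proof.
move=> c0 x0 cx1; set s := Num.sqrt x.
have s0 : 0 < s by rewrite sqrtr_gt0.
have xE : x = s ^+ 2 by rewrite sqr_sqrtr // ltW.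
have cs1 : c * s <= 1.
  by rewrite -(@expr_le1 _ 2) // ?exprMn -?xE // ltW // mulr_gt0.
pose e k := 1 - s * ns_scalar c x k.
pose q := e 0%N * (3 - e 0%N) / 2.
have e0_ge0 : 0 <= e 0%N by rewrite /e /ns_scalar /= mulrC subr_ge0.
have e0_lt1 : e 0%N < 1 by rewrite /e /ns_scalar /= gtrBl mulr_gt0.
have eS k : e k.+1 = e k * (e k * (3 - e k) / 2).
  rewrite /e /ns_scalar iterS -/(ns_scalar c x k) xE; by field.
have q0 : 0 <= q by rewrite /q; nra.
have q1 : q < 1 by rewrite /q; nra.
have ek k : 0 <= e k <= e 0%N /\ e k <= q ^+ k.
  elim: k => [|k [/andP[h1 h2] h3]]; first by rewrite e0_ge0 lexx expr0 ltW.
  have h : 0 <= e k * (3 - e k) / 2 <= q by rewrite /q; apply/andP; split; nra.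
  case/andP: h => h4 h5.
  have h6 : e k.+1 <= e k * q by rewrite eS ler_wpM2l.
  split; last by rewrite exprSr (le_trans h6) // ler_wpM2r.
  rewrite eS mulr_ge0 //= -eS (le_trans h6) // (le_trans _ h2) //.
  by rewrite ler_piMr // ltW.
have ecvg : e @ \oo --> 0.
  apply: (@squeeze_cvgr _ _ _ _ (cst 0) (GRing.exp q)).
  - by apply: nearW => k; rewrite /=; have [/andP[-> _] ->] := ek k.
  - exact: cvg_cst.
  - by apply: cvg_expr; rewrite ger0_norm.
rewrite (_ : ns_scalar c x = fun k => s^-1 * (1 - e k)); last first.
  by apply/funext => k; rewrite /e opprB addrC subrK mulKf // gt_eqF.
rewrite -[X in _ --> X]mulr1 -[X in _ * X]subr0.
by apply: cvgMr; apply: cvgB => //; exact: cvg_cst.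
Qed.

Lemma tr_gram_ge0 d m (G : 'M[R]_(d, m)) : 0 <= \tr (G *m G^T).
Proof.
by apply: sumr_ge0 => i _; rewrite mxE; apply: sumr_ge0 => j _; rewrite mxE -expr2 sqr_ge0.
Qed.

Lemma cvgn_sum (I : finType) (f : I -> nat -> R) (a : I -> R) :
  (forall i, f i @ \oo --> a i) -> (fun k => \sum_i f i k) @ \oo --> \sum_i a i.
Proof.
move=> fa; elim: (index_enum I) => [|i s IHs].
  by rewrite big_nil (_ : (fun _ => _) = cst 0); [exact: cvg_cst|apply/funext => k; rewrite big_nil].
rewrite big_cons (_ : (fun _ => _) = fun k => f i k + \sum_(j <- s) f j k).
  exact: cvgD.
by apply/funext => k; rewrite big_cons.
Qed.

Section Calculus.
Variables (d m : nat) (G : 'M[R]_(d, m)) (l : 'I_d -> R) (W : 'I_d -> 'M[R]_d).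
Hypothesis sd : spectral_data (G *m G^T) l W.
Local Notation Phi := (mxfun l W).
Local Notation c := ((1 + \tr (G *m G^T))^-1).

Lemma gram_spectral_ge0 i : 0 <= l i.
Proof. exact/gram_eigen_ge0/(char_poly_root_spectral sd). Qed.

Lemma mxfun_gram f g : (Phi f *m G) *m (Phi g *m G)^T = Phi (fun x => f x * x * g x).
Proof.
by rewrite trmx_mul (mxfun_tr sd) !mulmxA -(mulmxA _ G) -{1}(mxfun_id sd) !(mxfunM sd).
Qed.

Lemma gram_mx_eq0 k p (X : 'M[R]_(k, p)) : X *m X^T = 0 -> X = 0.
Proof.
move=> X0; apply/matrixP => i j; rewrite mxE.
have /matrixP/(_ i i) := X0; rewrite !mxE => /eqP.
rewrite psumr_eq0 => [/allP h|a _]; last by rewrite mxE -expr2 sqr_ge0.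
by have := h j; rewrite mem_index_enum mxE -expr2 sqrf_eq0 => /(_ isT)/eqP.
Qed.

(** The difference times [G] has Gram matrix Phi ((f - g)^2 x), which ignores the eigenvalue 0. This
    is what admits rank deficient [G]. *)
Lemma eq_mxfun_gram f g : (forall i, l i != 0 -> f (l i) = g (l i)) ->
  Phi f *m G = Phi g *m G.
Proof.
move=> fg; apply/eqP; rewrite -subr_eq0 -mulmxBl; apply/eqP.
have -> : Phi f - Phi g = Phi (fun x => f x - g x).
  by rewrite -sumrB; apply: eq_bigr => i _; rewrite scalerBl.
apply: gram_mx_eq0; rewrite mxfun_gram /mxfun big1 // => i _.
have [->|/fg ->] := eqVneq (l i) 0; first by rewrite mulr0 mul0r scale0r.
by rewrite subrr !mul0r scale0r.
Qed.

Lemma ns_iter_mxfun k : ns_iter G k = Phi (fun x => ns_scalar c x k) *m G.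
Proof.
have PhiZ a f : a *: Phi f = Phi (fun x => a * f x).
  by rewrite scaler_sumr; apply: eq_bigr => i _; rewrite scalerA.
elim: k => [|k IHk].
  rewrite /ns_iter /ns_scalar /= -[X in _ *: X](mul1mx G) -(mxfun1 sd) scalemxAl PhiZ.
  by congr (_ *m _); apply: eq_mxfun => i; rewrite mulr1.
rewrite /ns_iter iterS -/(ns_iter G k) /ns_step IHk mxfun_gram mulmxA (mxfunM sd).
rewrite !scalemxAl -mulmxBl !PhiZ -sumrB; congr (_ *m _); apply: eq_bigr => i _.
by rewrite -scalerBl /=; congr (_ *: _); rewrite exprSr expr2; ring.
Qed.

Lemma ns_iter_cvg i j : (fun k => ns_iter G k i j) @ \oo -->
  (Phi (fun x => (Num.sqrt x)^-1) *m G) i j.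
Proof.
(* At x = 0 the scalar iteration multiplies by 3/2 and diverges. The value there may be replaced by
   0, which matches the convention that the inverse of 0 is 0 in the limit. *)
pose h k x : R := if x == 0 then 0 else ns_scalar c x k.
have -> : (fun k => ns_iter G k i j) = fun k =>
    \sum_(a < d) (\sum_(b < d) h k (l b) * W b i a) * G a j.
  apply/funext => k; rewrite ns_iter_mxfun (@eq_mxfun_gram _ (h k)); last first.
    by move=> b b0; rewrite /h (negbTE b0).
  rewrite mxE; apply: eq_bigr => a _; rewrite summxE; congr (_ * _).
  by apply: eq_bigr => b _; rewrite mxE.
rewrite mxE; apply: cvgn_sum => a; apply: cvgMl; rewrite summxE; apply: cvgn_sum => b.
rewrite mxE; apply: cvgMl; rewrite /h.
have [->|l0] := eqVneq (l b) 0; first by rewrite sqrtr0 invr0; exact: cvg_cst.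
have lb : 0 < l b by rewrite lt_neqAle eq_sym l0 gram_spectral_ge0.
have t0 := tr_gram_ge0 G.
apply: ns_scalar_cvg => //; first by rewrite invr_gt0 ltr_pwDl.
(* With t the trace, c^2 l <= t / (1 + t)^2 <= 1, as the scalar convergence requires. *)
have lt : l b <= \tr (G *m G^T).
  rewrite -(mxfun_id sd) (mxtrace_mxfun sd) (bigD1 b) //= lerDl.
  by apply: sumr_ge0 => i0 _; exact: gram_spectral_ge0.
rewrite exprVn mulrC ler_pdivrMr ?mul1r ?exprn_gt0 ?ltr_pwDl //.
apply: (le_trans lt); nra.
Qed.

Lemma polar_nsE : polar_ns G = Phi (fun x => (Num.sqrt x)^-1) *m G.
Proof. by apply/matrixP => i j; rewrite mxE; apply/cvg_lim => //; exact: ns_iter_cvg. Qed.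
End Calculus.
End NewtonSchulz.

Section PolarFactor.
Variable R : realType.

Lemma gram_spectral_data d m (G : 'M[R]_(d, m)) : exists l W, spectral_data (G *m G^T) l W.
Proof. by apply: sym_functional_calculus; rewrite trmx_mul trmxK. Qed.

(** Two lists with the same product of linear factors are permutations of each other, so the list
    chosen inside [singvals] does not affect the sum. *)
Lemma sum_singvals d m (G : 'M[R]_(d, m)) l W : spectral_data (G *m G^T) l W ->
  \sum_(s <- singvals G) s = \sum_i Num.sqrt (l i).
Proof.
move=> sd; rewrite /singvals; case: xgetP => [s _ /= e|/(_ [seq l i | i <- index_enum 'I_d]) h]; last first.
  by case: h => /=; have [-> _ _ _ _] := sd; rewrite big_map.
have : perm_eq s [seq l i | i <- index_enum 'I_d].
  apply: prod_XsubC_eq; rewrite -e big_map; by have [-> _ _ _ _] := sd.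
by move=> ps; rewrite big_map (perm_big _ ps) big_map.
Qed.

(** The trace is the sum of l / sqrt(l) over the eigenvalues of the Gram matrix; a zero eigenvalue
    contributes 0 to both sides. *)
Lemma tr_polar_ns d m (G : 'M[R]_(d, m)) :
  \tr (polar_ns G *m G^T) = \sum_(s <- singvals G) s.
Proof.
have [l [W sd]] := gram_spectral_data G.
rewrite (polar_nsE sd) -mulmxA -(mxfun_id sd) (mxfunM sd) (mxtrace_mxfun sd) (sum_singvals sd).
apply: eq_bigr => i _; have l0 := gram_spectral_ge0 sd i.
rewrite -[X in _ * X](sqr_sqrtr l0) expr2 mulrA.
have [->|s0] := eqVneq (Num.sqrt (l i)) 0; first by rewrite mulr0.
by rewrite mulVf // mul1r.
Qed.

(** Z Z^T is the functional calculus of the indicator of x != 0, hence at most the identity. The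
    bound supplies the domination behind integrability of the cross moments. *)
Lemma polar_ns_le1 d m (G : 'M[R]_(d, m)) i j : `|polar_ns G i j| <= 1.
Proof.
have [l [W sd]] := gram_spectral_data G.
set Z := polar_ns G.
have Z1 : (Z *m Z^T) i i <= 1.
  rewrite /Z (polar_nsE sd) (mxfun_gram sd).
  have quad_diag (M : 'M[R]_d) : M i i = ((delta_mx i 0 : 'cV_d)^T *m M *m (delta_mx i 0 : 'cV_d)) 0 0.
    by rewrite -colE trmx_delta -rowE !mxE.
  have -> : 1 = mxfun l W (fun=> 1) i i by rewrite (mxfun1 sd) mxE eqxx.
  rewrite !(quad_diag (mxfun _ _ _)) !quad_mxfun; apply: ler_sum => a _.
  apply: ler_wpM2r; first exact: (quad_spectral_ge0 sd).
  have l0 := gram_spectral_ge0 sd a.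
  have [->|s0] := eqVneq (l a) 0; first by rewrite !mulr0 mul0r.
  rewrite -{2}(sqr_sqrtr l0) expr2 mulrA mulVf ?mul1r ?mulfV //;
    by rewrite sqrtr_eq0 -ltNge lt_neqAle eq_sym s0.
rewrite -(@expr_le1 _ 2) // -normrX ger0_norm ?sqr_ge0 //; apply: le_trans Z1.
rewrite [leRHS]mxE (bigD1 j) //= [Z^T j i]mxE -expr2 lerDl.
by apply: sumr_ge0 => b _; rewrite [Z^T b i]mxE -expr2 sqr_ge0.
Qed.

(** Each iteration step commutes with left multiplication by an orthogonal matrix, and the starting
    scale is invariant under it. *)
Lemma polar_ns_mull d m (H : 'M[R]_d) (G : 'M[R]_(d, m)) : H^T *m H = 1%:M ->
  polar_ns (H *m G) = H *m polar_ns G.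
Proof.
move=> HH; have HG (Y : 'M[R]_(d, m)) : ns_step (H *m Y) = H *m ns_step Y.
  rewrite /ns_step mulmxBr -!scalemxAr trmx_mul !mulmxA.
  by rewrite -[_ *m H^T *m H]mulmxA HH mulmx1.
have E k : ns_iter (H *m G) k = H *m ns_iter G k.
  elim: k => [|k IHk].
    rewrite /ns_iter /= -scalemxAr trmx_mul; congr (_^-1 *: _); congr (_ + _).
    by rewrite -mulmxA mxtrace_mulC -!mulmxA HH mulmx1.
  by rewrite /ns_iter !iterS -!/(ns_iter _ _) IHk HG.
have [l [W sd]] := gram_spectral_data G.
apply/matrixP => i j; rewrite mxE; apply/cvg_lim => //.
under eq_fun do rewrite E mxE.
rewrite mxE; apply: cvgn_sum => a; apply: cvgMr; rewrite (polar_nsE sd).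
exact: ns_iter_cvg.
Qed.

Lemma quad_col d m (S : 'M[R]_d) (X : 'M[R]_(d, m)) j :
  (X^T *m S *m X) j j = ((col j X)^T *m S *m col j X) 0 0.
Proof.
rewrite [LHS]mxE [RHS]mxE; apply: eq_bigr => a _.
by rewrite [in LHS]mxE [in RHS]mxE [X in _ = _ * X]mxE; congr (_ * _); apply: eq_bigr => b _; rewrite !mxE.
Qed.

Lemma frobE p q (A : 'M[R]_(p, q)) : frob A = Num.sqrt (\tr (A *m A^T)).
Proof.
rewrite /frob; congr Num.sqrt; apply: eq_bigr => i _; rewrite mxE.
by apply: eq_bigr => j _; rewrite mxE expr2.
Qed.

(** Here G = S Z with S the square root of G G^T. Full rank makes S positive definite, so Z is the
    only minimizer, which pins down the choice made in [polar]. *)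
Lemma polarE d m (G : 'M[R]_(d, m)) : \det (G *m G^T) != 0 ->
  stiefel (polar_ns G) /\ polar G = polar_ns G.
Proof.
move=> detG; have [l [W sd]] := gram_spectral_data G.
have l0 i : 0 < l i.
  rewrite lt_neqAle (gram_spectral_ge0 sd) andbT eq_sym.
  by move: detG; rewrite (det_spectral sd) => /prodf_neq0 ->.
have s0 i : 0 < Num.sqrt (l i) by rewrite sqrtr_gt0.
set Z := polar_ns G; have ZE : Z = _ := polar_nsE sd.
have sZ : stiefel Z.
  rewrite /stiefel ZE (mxfun_gram sd) -(mxfun1 sd); apply: eq_mxfun => i.
  by rewrite -{2}(sqr_sqrtr (ltW (l0 i))) expr2 mulrA mulVf ?gt_eqF // mul1r mulfV ?gt_eqF.
split=> //.
pose S := mxfun l W Num.sqrt.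
have GE : G = S *m Z.
  rewrite ZE mulmxA (mxfunM sd) -[LHS]mul1mx -(mxfun1 sd); congr (_ *m _).
  by apply: eq_mxfun => i; rewrite mulfV ?gt_eqF.
(* For [Z' Z'^T = 1], |Z' - G|^2 - |Z - G|^2 = tr ((Z' - Z)^T S (Z' - Z)) *)
have key Z' : stiefel Z' -> \tr ((Z' - G) *m (Z' - G)^T) =
    \tr ((Z - G) *m (Z - G)^T) + \tr ((Z' - Z)^T *m S *m (Z' - Z)).
  move=> sZ'; rewrite GE.
  have SS : S^T = S := mxfun_tr sd _.
  rewrite -mulmxA (mxtrace_mulC (Z' - Z)^T) -mulmxA.
  have tB (M N : 'M[R]_(d, m)) : (M - N)^T = M^T - N^T by apply/matrixP => i j; rewrite !mxE.
  rewrite !tB !trmx_mul SS !(mulmxBl, mulmxBr) !mulmxA.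
  rewrite /stiefel in sZ sZ'.
  rewrite -!(mulmxA S) sZ sZ' -!mulmxA !(mulmxA _ (_^T)) ?sZ ?sZ'.
  have e1 : \tr (Z' *m (Z^T *m S)) = \tr (S *m (Z' *m Z^T)).
    by rewrite mulmxA mxtrace_mulC.
  have e2 : \tr (S *m (Z *m Z'^T)) = \tr (S *m (Z' *m Z^T)).
    by rewrite -mxtrace_tr !trmx_mul trmxK SS mxtrace_mulC.
  by rewrite !mul1mx !mulmx1 !raddfB /= -(mulmxA Z') e1 e2; ring.
have quadZ Z' : \tr ((Z' - Z)^T *m S *m (Z' - Z)) =
    \sum_j ((col j (Z' - Z))^T *m S *m col j (Z' - Z)) 0 0.
  by apply: eq_bigr => j _; exact: quad_col.
have qge0 Z' : 0 <= \tr ((Z' - Z)^T *m S *m (Z' - Z)).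
  rewrite quadZ; apply: sumr_ge0 => j _; rewrite quad_mxfun; apply: sumr_ge0 => i _.
  by rewrite mulr_ge0 ?(quad_spectral_ge0 sd) // ltW.
rewrite /polar; apply: xget_unique => /=.
  split=> // Z' sZ'; rewrite !frobE ler_sqrt ?tr_gram_ge0 //.
  by rewrite (key Z') // lerDl.
move=> Z' [sZ' minZ']; have := minZ' _ sZ; rewrite !frobE ler_sqrt ?tr_gram_ge0 //.
rewrite (key Z') // gerDl => q0; have : \tr ((Z' - Z)^T *m S *m (Z' - Z)) == 0.
  by rewrite eq_le q0 qge0.
rewrite quadZ psumr_eq0 => [/allP h|j _]; last first.
  rewrite quad_mxfun; apply: sumr_ge0 => i _.
  by rewrite mulr_ge0 ?(quad_spectral_ge0 sd) // ltW.
apply/eqP; rewrite -subr_eq0; apply/eqP/matrixP => i j; rewrite [RHS]mxE.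
have : col j (Z' - Z) = 0.
  apply/eqP; apply: contraT => c0.
  have := quad_mxfun_gt0 sd s0 c0.
  have := h j; rewrite mem_index_enum => /(_ isT)/eqP ->; by rewrite ltxx.
by move/colP/(_ i); rewrite !mxE.
Qed.

Lemma gram_sqrt N m (O : 'M[R]_(N, m)) : exists Y : 'M[R]_N, Y *m Y^T = O *m O^T.
Proof.
have [l [W sd]] := gram_spectral_data O.
exists (mxfun l W Num.sqrt); rewrite (mxfun_tr sd) (mxfunM sd) -[RHS](mxfun_id sd).
apply: eq_mxfun => i; rewrite -expr2 sqr_sqrtr //; exact: (gram_spectral_ge0 sd).
Qed.
End PolarFactor.

(** * The block objective *)

Section BlockObjective.
Variables (R : realType) (n d : nat).
Implicit Type C : 'M[R]_(n * d).

(** The bilinear form whose diagonal is [obj]; it carries the cross term between V_i and X_i R. *)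
Definition obj2 m C (V U : 'I_n -> 'M[R]_(d, m)) : R :=
  \sum_(i < n) \sum_(j < n) \tr ((block C i j)^T *m V i *m (U j)^T).

Lemma bidx_bij : bijective (fun k : 'I_n * 'I_d => bidx k.1 k.2).
Proof.
apply: inj_card_bij; last by rewrite card_prod !card_ord.
move=> [i a] [j b] /(congr1 val) /= e.
have d0 : (0 < d)%N by case: a {e} => a; exact: leq_trans.
have /val_inj -> : val i = val j.
  by have := congr1 (divn^~ d) e; rewrite /= !divnMDl // !divn_small // !addn0.
by have /val_inj -> : val a = val b by have := congr1 (modn^~ d) e; rewrite /= !modnMDl !modn_small.
Qed.

Lemma sum_bidx (f : 'I_(n * d) -> R) : \sum_p f p = \sum_i \sum_a f (bidx i a).
Proof. by rewrite (reindex _ (onW_bij _ bidx_bij)) pair_big. Qed.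

Definition rowblock m (M : 'M[R]_(n * d, m)) (i : 'I_n) : 'M[R]_(d, m) :=
  \matrix_(a, k) M (bidx i a) k.

(** Stacking a family into one matrix M turns the objective into the trace of M^T C M, where
    semidefiniteness and symmetry of C apply directly. *)
Lemma rowblockP m (V : 'I_n -> 'M[R]_(d, m)) : exists M, V = rowblock M.
Proof.
have [g bK gK] := bidx_bij; exists (\matrix_(p, k) V (g p).1 (g p).2 k).
by apply/funext => i; apply/matrixP => a k; rewrite !mxE (bK (i, a)).
Qed.

Lemma obj2_rowblock m C (M N : 'M[R]_(n * d, m)) :
  obj2 C (rowblock M) (rowblock N) = \tr (M^T *m C *m N).
Proof.
transitivity (\tr (M *m (N^T *m C^T))); last first.
  by rewrite -[RHS]mxtrace_tr !trmx_mul !trmxK mxtrace_mulC mulmxA.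
rewrite [RHS]/mxtrace sum_bidx; apply: eq_bigr => i _.
transitivity (\tr (rowblock M i *m \sum_j ((rowblock N j)^T *m (block C i j)^T))).
  rewrite mulmx_sumr raddf_sum; apply: eq_bigr => j _.
  by rewrite -mulmxA mxtrace_mulC mulmxA.
apply: eq_bigr => a _; rewrite [LHS]mxE [RHS]mxE; apply: eq_bigr => k _.
rewrite [rowblock M i a k]mxE; congr (_ * _); rewrite summxE mxE sum_bidx.
by apply: eq_bigr => j _; rewrite mxE; apply: eq_bigr => b _; rewrite !mxE.
Qed.

Lemma obj_ge0 m C (V : 'I_n -> 'M[R]_(d, m)) : psd C -> 0 <= obj C V.
Proof.
move=> [_ C0]; have [M ->] := rowblockP V; rewrite -[obj _ _]/(obj2 _ _ _) obj2_rowblock.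
by apply: sumr_ge0 => k _; rewrite quad_col; exact: C0.
Qed.

Lemma obj2C m C (V U : 'I_n -> 'M[R]_(d, m)) : C^T = C -> obj2 C V U = obj2 C U V.
Proof.
move=> sC; have [M ->] := rowblockP V; have [N ->] := rowblockP U.
by rewrite !obj2_rowblock -mxtrace_tr !trmx_mul trmxK sC mulmxA.
Qed.

(* This is [0 <= obj C (V - c U)]. *)
Lemma obj_tangent m C (V U : 'I_n -> 'M[R]_(d, m)) (c : R) : psd C ->
  2 * c * obj2 C V U - c ^+ 2 * obj C U <= obj C V.
Proof.
move=> psdC; have := obj_ge0 (fun i => V i - c *: U i) psdC.
have := obj2C V U psdC.1; have [M ->] := rowblockP V; have [N ->] := rowblockP U.
have -> : (fun i => rowblock M i - c *: rowblock N i) = rowblock (M - c *: N).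
  by apply/funext => i; apply/matrixP => a k; rewrite !mxE.
rewrite -![obj _ _]/(obj2 _ _ _) !obj2_rowblock => sym.
have tB (A B : 'M[R]_(n * d, m)) : (A - c *: B)^T = A^T - c *: B^T by apply/matrixP => i j; rewrite !mxE.
rewrite tB !(mulmxBl, mulmxBr) -!(scalemxAl, scalemxAr) !raddfB /= !mxtraceZ -sym.
by nra.
Qed.

(** Objective and feasibility depend on the stacked matrix only through its Gram matrix: feasibility
    says that its diagonal blocks are identities. *)
Lemma sup_obj_le m C (X : 'I_n -> 'M[R]_(d, n * d)) (O : 'I_n -> 'M[R]_(d, m)) :
  optimal C X -> (forall i, stiefel (O i)) -> obj C O <= obj C X.
Proof.
move=> [_ optX] sO; have [M OM] := rowblockP O; have [Y YM] := gram_sqrt M.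
have -> : obj C O = obj C (rowblock Y).
  rewrite OM -![obj _ _]/(obj2 _ _ _) !obj2_rowblock -!mulmxA mxtrace_mulC [RHS]mxtrace_mulC.
  by rewrite -!mulmxA YM.
have gramE k (N : 'M[R]_(n * d, k)) i : rowblock N i *m (rowblock N i)^T =
    \matrix_(a, b) (N *m N^T) (bidx i a) (bidx i b).
  by apply/matrixP => a b; rewrite !mxE; apply: eq_bigr => j _; rewrite !mxE.
by apply: optX => i; rewrite /stiefel gramE YM -gramE -OM; exact: sO.
Qed.
End BlockObjective.

(** * Givens rotations *)

Section GivensReduction.
Variables (R : rcfType) (N : nat).
Implicit Types (H : 'M[R]_N).

Definition givens (a b : 'I_N) (c s : R) : 'M[R]_N :=
  \matrix_(i, j) if i == a then c * (j == a)%:R + s * (j == b)%:R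
                 else if i == b then c * (j == b)%:R - s * (j == a)%:R
                 else (j == i)%:R.

Definition flip (b : 'I_N) : 'M[R]_N := diag_mx (\row_i (-1) ^+ (i == b)).

Lemma sum_delta (I : finType) (f : I -> R) i : \sum_j (j == i)%:R * f j = f i.
Proof.
by rewrite (bigD1 i) //= eqxx mul1r big1 ?addr0 // => j /negbTE ->; rewrite mul0r.
Qed.

Lemma givens_mulE m a b c s (M : 'M[R]_(N, m)) i k :
  (givens a b c s *m M) i k = if i == a then c * M a k + s * M b k
                              else if i == b then c * M b k - s * M a k else M i k.
Proof.
rewrite mxE; under eq_bigr do rewrite mxE.
case: ifP => _; last case: ifP => _; last by rewrite sum_delta.
  under eq_bigr do rewrite mulrDl -!mulrA.
  by rewrite big_split /= -!mulr_sumr !sum_delta.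
under eq_bigr do rewrite mulrBl -!mulrA.
by rewrite sumrB /= -!mulr_sumr !sum_delta.
Qed.

Lemma flip_mulE m b (M : 'M[R]_(N, m)) i k : (flip b *m M) i k = (-1) ^+ (i == b) * M i k.
Proof. by rewrite mul_diag_mx !mxE. Qed.

Lemma givens_orth a b c s : a != b -> c ^+ 2 + s ^+ 2 = 1 ->
  (givens a b c s)^T *m givens a b c s = 1%:M.
Proof.
move=> ab cs1; apply: mulmx1C; apply/matrixP => i j; rewrite givens_mulE !mxE.
have ba : (b == a) = false by rewrite eq_sym (negbTE ab).
rewrite !eqxx ba (negbTE ab) ?[a == j]eq_sym ?[b == j]eq_sym.
have ne (x y : 'I_N) : x != y -> (x == y = false) * (y == x = false).
  by move=> xy; split; [|rewrite eq_sym]; exact: negbTE.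
case: (eqVneq i a) => [e|ia]; [|case: (eqVneq i b) => [e|ib]]; rewrite ?e;
  (case: (eqVneq j a) => [f|ja]; [|case: (eqVneq j b) => [f|jb]]); rewrite ?f;
  rewrite ?eqxx ?ba ?(negbTE ab) ?(ne _ _ ia) ?(ne _ _ ib) ?(ne _ _ ja) ?(ne _ _ jb) //=;
  rewrite ?(eq_sym j i) ?mulr0 ?mulr1 ?addr0 ?sub0r ?subr0 -?cs1; ring.
Qed.

Lemma flip_orth b : (flip b)^T *m flip b = 1%:M.
Proof.
rewrite tr_diag_mx; apply/matrixP => i j; rewrite flip_mulE !mxE.
case: (eqVneq i j) => [_|_] /=; last by rewrite !mulr0n mulr0.
by rewrite !mulr1n -expr2 sqrr_sign.
Qed.

Variable K : 'M[R]_N -> Prop.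
Hypothesis K1 : K 1%:M.
Hypothesis KM : forall H1 H2, K H1 -> K H2 -> K (H1 *m H2).
Hypothesis Kgivens : forall a b c s, a != b -> c ^+ 2 + s ^+ 2 = 1 -> c != -1 ->
  K (givens a b c s).
Hypothesis Kflip : forall b, K (flip b).
Local Notation orth H := (H^T *m H = 1%:M).

(** Each rotation moves one nonzero entry of [y] into position [p], by induction on the number of
    such entries. The last clause, that basis vectors at zero positions of [y] stay fixed, protects
    the columns already reduced. [K] will be the class of matrices preserving the Gaussian law. *)
Lemma givens_column (y : 'cV[R]_N) (p : 'I_N) : exists H rho,
  [/\ K H, orth H, 0 <= rho, H *m y = rho *: delta_mx p 0 &
      forall i, i != p -> y i 0 = 0 -> H *m (delta_mx i 0 : 'cV_N) = delta_mx i 0].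
Proof.
have [k] := ubnP #|[pred i | (i != p) && (y i 0 != 0)]|.
elim: k y => // k IHk y; rewrite ltnS => yk.
have [/existsP[i /andP[ip yi]]|] := boolP [exists i, (i != p) && (y i 0 != 0)]; last first.
  rewrite negb_exists => /forallP y0.
  have yE : y = y p 0 *: delta_mx p 0.
    apply/colP => i; rewrite !mxE eqxx andbT; have := y0 i; rewrite negb_and !negbK.
    by case: eqVneq => [->|_] /=; [rewrite mulr1|move/eqP->; rewrite mulr0].
  have [yp|yp] := leP 0 (y p 0).
    by exists 1%:M, (y p 0); split=> //; rewrite ?trmx1 ?mul1mx // => i _ _; rewrite mul1mx.
  exists (flip p), (- y p 0); split=> //; [exact: flip_orth|by rewrite oppr_ge0 ltW| |].
    rewrite {1}yE; apply/colP => i; rewrite flip_mulE !mxE eqxx andbT.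
    by case: eqVneq => _; rewrite ?expr1 ?mulr1 ?mulr0 // mulN1r.
  move=> i ip _; apply/colP => j; rewrite flip_mulE !mxE eqxx andbT.
  by case: (eqVneq j i) => [->|_]; rewrite ?(negbTE ip) ?mulr0 ?mul1r.
pose rho := Num.sqrt (y p 0 ^+ 2 + y i 0 ^+ 2).
have rho0 : 0 < rho by rewrite sqrtr_gt0 ltr_wpDl ?sqr_ge0 // exprn_even_gt0.
have rho2 : rho ^+ 2 = y p 0 ^+ 2 + y i 0 ^+ 2 by rewrite sqr_sqrtr // addr_ge0 ?sqr_ge0.
pose c := y p 0 / rho; pose s := y i 0 / rho.
have cs1 : c ^+ 2 + s ^+ 2 = 1.
  by rewrite /c /s !expr_div_n -mulrDl -rho2 divff // expf_neq0 // gt_eqF.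
(* The half-turn is never met: c = -1 would give s = 0, but y_i is nonzero. *)
have cN1 : c != -1.
  apply/eqP => c1; move: cs1; rewrite c1 sqrrN expr1n => /eqP.
  rewrite -subr_eq0 addrAC subrr add0r sqrf_eq0 /s mulf_eq0 (negbTE yi) /= invr_eq0.
  by rewrite gt_eqF.
have pi : p != i by rewrite eq_sym.
set G := givens p i c s; have G_mul := @givens_mulE 1 p i c s.
have Gi : (G *m y) i 0 = 0.
  by rewrite G_mul (negbTE ip) eqxx /c /s mulrAC mulrC mulrAC; ring.
have Gj j : j != p -> j != i -> (G *m y) j 0 = y j 0.
  by move=> jp ji; rewrite G_mul (negbTE jp) (negbTE ji).
have [H [t [KH oH t0 Hy Hfix]]] : exists H rho,
  [/\ K H, orth H, 0 <= rho, H *m (G *m y) = rho *: delta_mx p 0 &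
      forall j, j != p -> (G *m y) j 0 = 0 -> H *m (delta_mx j 0 : 'cV_N) = delta_mx j 0].
  apply: IHk; apply: leq_trans yk; apply: proper_card; apply/properP; split.
    apply/fintype.subsetP => j; rewrite !inE => /andP[jp]; rewrite jp /=.
    by have [->|ji] := eqVneq j i; [rewrite Gi eqxx|rewrite Gj].
  by exists i; rewrite !inE ip // Gi eqxx.
exists (H *m G), t; split=> //; first by apply: KM => //; exact: Kgivens.
- by rewrite trmx_mul !mulmxA -(mulmxA _ H^T) oH mulmx1 givens_orth.
- by rewrite -mulmxA.
move=> j jp yj; have ji : j != i by apply: contraNneq yi => <-; rewrite yj.
have -> : H *m G *m (delta_mx j 0 : 'cV_N) = H *m (delta_mx j 0 : 'cV_N).
  rewrite -mulmxA; congr (_ *m _); apply/colP => a; rewrite G_mul !mxE.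
  rewrite !eqxx !andbT ![_ == j]eq_sym (negbTE jp) (negbTE ji) !mulr0 addr0 subr0.
  case: eqVneq => [->|_]; first by rewrite (negbTE jp).
  by case: eqVneq => [->|//]; rewrite (negbTE ji).
by apply: Hfix => //; rewrite Gj.
Qed.

(** This is a QR reduction of the rows of X. Orthonormality forces the triangular factor to be the
    identity. *)
Lemma givens_reduction d (X : 'M[R]_(d, N)) (dN : (d <= N)%N) : X *m X^T = 1%:M ->
  exists H, [/\ K H, orth H & X = (\matrix_(a, j) (j == widen_ord dN a)%:R) *m H].
Proof.
move=> XX; set w := widen_ord dN; pose x a := (row a X)^T.
have xx a b : (x a)^T *m x b = ((a == b)%:R)%:M.
  rewrite /x trmxK; apply/matrixP => i j; rewrite !ord1 [RHS]mxE mulr1n.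
  by have /matrixP/(_ a b) := XX; rewrite !mxE => <-; apply: eq_bigr => k _; rewrite !mxE.
suff [H [KH oH Hx]] : exists H, [/\ K H, orth H & forall a : 'I_d, H *m x a = delta_mx (w a) 0].
  exists H; split=> //; have -> : X = (H *m X^T)^T *m H by rewrite trmx_mul trmxK -mulmxA oH mulmx1.
  congr (_ *m _); apply/matrixP => a j; rewrite !mxE.
  have /colP/(_ j) := Hx a; rewrite !mxE eqxx andbT => <-.
  by apply: eq_bigr => k _; rewrite !mxE.
suff: forall k, exists H, [/\ K H, orth H & forall a : 'I_d, (a < k)%N -> H *m x a = delta_mx (w a) 0].
  by move=> /(_ d) [H [KH oH Hx]]; exists H; split=> // a; exact: Hx.
elim=> [|k [H [KH oH Hx]]]; first by exists 1%:M; split=> //; rewrite trmx1 mul1mx.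
have [kd|dk] := ltnP k d; last first.
  by exists H; split=> // a _; apply: Hx; exact: leq_trans (ltn_ord a) dk.
pose b := Ordinal kd; have [H' [t [KH' oH' t0 H'y H'fix]]] := givens_column (H *m x b) (w b).
exists (H' *m H); split; first exact: KM.
  by rewrite trmx_mul !mulmxA -(mulmxA _ H'^T) oH' mulmx1.
move=> a; rewrite ltnS leq_eqVlt => /orP[/eqP ak|ak].
  have -> : a = b by apply: val_inj.
  (* Norms are preserved, so t^2 = 1; the sign was fixed by the final flip in [givens_column]. *)
  rewrite -mulmxA H'y; suff -> : t = 1 by rewrite scale1r.
  have /matrixP/(_ 0 0) := xx b b.
  have -> : (x b)^T *m x b = (H' *m (H *m x b))^T *m (H' *m (H *m x b)).
    by rewrite !trmx_mul !mulmxA -(mulmxA _ H'^T) oH' mulmx1 -(mulmxA _ H^T) oH mulmx1.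
  rewrite H'y; have -> : (t *: delta_mx (w b) 0 : 'cV[R]_N)^T = t *: delta_mx 0 (w b).
    by apply/matrixP => i j; rewrite !mxE andbC.
  rewrite -scalemxAl -scalemxAr mul_delta_mx !mxE !eqxx mulr1n mulr1.
  by move/eqP; rewrite -expr2 sqrf_eq1 => /orP[/eqP//|/eqP t1]; move: t0; rewrite t1 oppr_ge0 ler10.
rewrite -mulmxA Hx // H'fix //; first by rewrite -val_eqE /= ltn_eqF.
(* Orthogonality of rows a and b says that coordinate [w a] of [H *m x b] vanishes, so [H'] leaves
   the earlier basis vector alone. *)
have : ((H *m x a)^T *m (H *m x b)) 0 0 = 0.
  rewrite trmx_mul mulmxA -(mulmxA _ H^T) oH mulmx1 xx !mxE -val_eqE /=.
  by rewrite ltn_eqF.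
by rewrite Hx // trmx_delta -rowE !mxE.
Qed.
End GivensReduction.

(** * Gaussian measures on the line and the plane *)

Section LebesgueTranslation.
Context {R : realType}.
Local Notation mu := (@lebesgue_measure R).
Local Open Scope ereal_scope.

Lemma measurable_addr (t : R) : measurable_fun setT (fun x : measurableTypeR R => (x + t)%R : measurableTypeR R).
Proof. exact: measurable_funD. Qed.

Lemma lebesgue_measureD (t : R) (A : set R) : measurable A ->
  pushforward mu (fun x : measurableTypeR R => (x + t)%R : measurableTypeR R) A = mu A.
Proof.
move=> mA; apply/esym/lebesgue_measure_unique => //=; first exact: measurable_addr.
move=> _ _ [[a b]] _ <-.
rewrite /pushforward (_ : _ @^-1` _ = `](a - t)%R, (b - t)%R]%classic); last first.
  by apply/seteqP; split => x /=; rewrite !in_itv /= ltrBlDr lerBrDr.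
rewrite !lebesgue_measure_itv /= !lte_fin ltrD2r; case: ifP => // _.
by rewrite -!EFinD; congr EFin; ring.
Qed.

Lemma ge0_integral_shift (t : R) (f : R -> \bar R) :
  measurable_fun setT f -> (forall x, 0 <= f x) ->
  \int[mu]_x f (x + t)%R = \int[mu]_x f x.
Proof.
move=> mf f0; rewrite -[LHS](@ge0_integral_pushforward _ _ _ _ _ _ (measurable_addr t) mu setT) //.
by apply: eq_measure_integral => [|m A mA _]; [exact: measurable_addr|exact: lebesgue_measureD].
Qed.

Lemma ge0_integral_opp (f : R -> \bar R) :
  measurable_fun setT f -> (forall x, 0 <= f x) ->
  \int[mu]_x f (- x)%R = \int[mu]_x f x.
Proof.
move=> mf f0.
have mN : measurable_fun setT (-%R : measurableTypeR R -> measurableTypeR R) by exact: oppr_measurable.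
rewrite -[LHS](@ge0_integral_pushforward _ _ _ _ _ _ mN mu setT) //.
by apply: eq_measure_integral => /= A mA _; exact: lebesgue_measureN.
Qed.
End LebesgueTranslation.

Section Gaussian.
Context {R : realType} (sigma : R).
Hypothesis sigma0 : sigma != 0.
Local Notation mu := (@lebesgue_measure R).
Local Notation phi := (normal_pdf 0 sigma).
Local Notation gam := (normal_prob 0 sigma).
Local Open Scope ereal_scope.

(** The Radon-Nikodym derivative and the density have the same integral over every measurable set,
    hence agree almost everywhere. *)
Lemma ge0_integral_normal_prob (f : R -> \bar R) :
  measurable_fun setT f -> (forall x, 0 <= f x) ->
  \int[gam]_x f x = \int[mu]_x (f x * (phi x)%:E).
Proof.
move=> mf f0; have dom := normal_prob_dominates 0 sigma.
rewrite -(Radon_Nikodym_SigmaFinite.change_of_variables dom) //.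
apply: ae_eq_integral => //.
- apply: emeasurable_funM => //; apply: measurable_int (Radon_Nikodym_SigmaFinite.f_integrable dom).
- by apply: emeasurable_funM => //; apply/measurable_EFinP; exact: measurable_normal_pdf.
apply: ae_eqe_mul2l; apply: integral_ae_eq => //.
- exact: Radon_Nikodym_SigmaFinite.f_integrable.
- by apply/measurable_EFinP; exact: measurable_normal_pdf.
by move=> A _ mA; rewrite -(Radon_Nikodym_SigmaFinite.f_integral dom).
Qed.

Lemma normal_pdfN x : phi (- x)%R = phi x.
Proof. by rewrite !normal_pdfE //= /normal_fun !subr0 sqrrN. Qed.

Lemma normal_probN (A : set R) : measurable A -> gam (-%R @^-1` A) = gam A.
Proof.
move=> mA; rewrite /normal_prob.
rewrite integral_mkcond [RHS]integral_mkcond -[RHS]ge0_integral_opp.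
- by apply: eq_integral => x _; rewrite !patchE normal_pdfN (_ : (x \in _) = (- x \in A)%R) //; apply/idP/idP; rewrite !inE.
- apply/(measurable_restrictT _ mA); apply/measurable_funTS/measurable_EFinP.
  exact: measurable_normal_pdf.
- by move=> x; rewrite patchE; case: ifP => // _; rewrite lee_fin normal_pdf_ge0.
Qed.

Lemma normal_prob1 (x : R) : gam [set x] = 0.
Proof.
have := normal_prob_dominates 0 sigma.
move/null_content_dominatesP => h. apply: h => //; exact: lebesgue_measure_set1.
Qed.
End Gaussian.

Section PlaneRotation.
Context {R : realType}.
Local Notation mu := (@lebesgue_measure R).
Local Open Scope ereal_scope.
Implicit Type g : R * R -> \bar R.

Definition rot2 (c s : R) (z : R * R) : R * R :=
  (c * z.1 + s * z.2, c * z.2 - s * z.1)%R.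

Lemma measurable_rot2 c s : measurable_fun setT (rot2 c s).
Proof.
apply/measurable_fun_pairP; split => /=.
  by apply: measurable_funD; apply: measurable_funM.
by apply: measurable_funB; apply: measurable_funM.
Qed.

Lemma measurable_shear1 t : measurable_fun setT (fun z : R * R => (z.1, z.2 + t * z.1)%R).
Proof.
apply/measurable_fun_pairP; split; first exact: measurable_fst.
by apply: measurable_funD; [exact: measurable_snd|apply: measurable_funM].
Qed.

Lemma measurable_shear2 t : measurable_fun setT (fun z : R * R => (z.1 + t * z.2, z.2)%R).
Proof.
apply/measurable_fun_pairP; split; last exact: measurable_snd.
by apply: measurable_funD; [exact: measurable_fst|apply: measurable_funM].
Qed.

(** In iterated form a shear is a translation of one variable with the other frozen; Tonelli
    exchanges the order for the second kind of shear. *)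
Let I2 g := \int[mu]_x \int[mu]_y g (x, y).

Lemma ge0_integral_shear1 t g : measurable_fun setT g -> (forall z, 0 <= g z) ->
  I2 (fun z : R * R => g (z.1, z.2 + t * z.1)%R) = I2 g.
Proof.
move=> mg g0; apply: eq_integral => x _ /=.
rewrite -(@ge0_integral_shift _ (t * x) (fun y => g (x, y))) //.
exact: (measurableT_comp mg (pair1_measurable x)).
Qed.

Lemma ge0_integral_shear2 t g : measurable_fun setT g -> (forall z, 0 <= g z) ->
  I2 (fun z : R * R => g (z.1 + t * z.2, z.2)%R) = I2 g.
Proof.
move=> mg g0; rewrite /I2.
have mh : measurable_fun setT (fun z : R * R => g (z.1 + t * z.2, z.2)%R).
  exact: (measurableT_comp mg (measurable_shear2 t)).
apply: (etrans (@fubini_tonelli _ _ _ _ _ mu mu _ mh (fun=> g0 _))).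
apply: (etrans _ (esym (@fubini_tonelli _ _ _ _ _ mu mu g mg g0))).
apply: eq_integral => y _ /=.
rewrite -(@ge0_integral_shift _ (t * y) (fun x => g (x, y))) //.
exact: (measurableT_comp mg (pair2_measurable y)).
Qed.

(* A rotation other than the half-turn is a product of three shears. *)
Lemma ge0_integral_rot2 c s g : (c ^+ 2 + s ^+ 2 = 1)%R -> (c != -1)%R ->
  measurable_fun setT g -> (forall z, 0 <= g z) ->
  I2 (fun z => g (rot2 c s z)) = I2 g.
Proof.
move=> cs1 cN1 mg g0; have c1 : (1 + c != 0)%R by rewrite addrC -[X in (_ + X)%R]opprK subr_eq0.
(* For an angle with cosine c and sine s this is the tangent of the half angle, infinite exactly at
   the half-turn. *)
pose t := (s / (1 + c))%R.
pose h1 := (fun z : R * R => g (z.1 + t * z.2, z.2)%R).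
pose h2 := (fun z : R * R => h1 (z.1, z.2 + (- s) * z.1)%R).
have mh1 : measurable_fun setT h1.
  exact: (measurableT_comp mg (measurable_shear2 t)).
have mh2 : measurable_fun setT h2.
  exact: (measurableT_comp mh1 (measurable_shear1 (- s))).
have E1 := ge0_integral_shear2 t mg g0.
have E2 := ge0_integral_shear1 (- s) mh1 (fun=> g0 _).
have E3 := ge0_integral_shear2 t mh2 (fun=> g0 _).
rewrite -E1 -E2 -E3; congr I2; apply/funext => -[x y].
have s2 : (s ^+ 2 = (1 - c) * (1 + c))%R.
  by have -> : (s ^+ 2 = 1 - c ^+ 2)%R; [rewrite -cs1; ring|ring].
have st : (s * t = 1 - c)%R by rewrite /t mulrA -expr2 s2 mulfK.
have tc : (t * (1 + c) = s)%R by rewrite /t divfK.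
rewrite /h2 /h1 /rot2 /=; congr (g (_, _)).
  transitivity ((1 - s * t) * x + t * (1 + (1 - s * t)) * y)%R; last by ring.
  by rewrite st -[in LHS]tc; ring.
transitivity ((1 - s * t) * y - s * x)%R; last by ring.
by rewrite st; ring.
Qed.

Variable sigma : R.
Hypothesis sigma0 : (sigma != 0)%R.
Local Notation phi := (normal_pdf 0 sigma).
Local Notation gam := (normal_prob 0 sigma).

Lemma measurable_phi2 : measurable_fun setT (fun z : R * R => phi z.1 * phi z.2)%R.
Proof.
by apply: measurable_funM; apply: (measurableT_comp (measurable_normal_pdf _ _)).
Qed.

Lemma normal_prob2E (D : set (R * R)) : measurable D ->
  (gam \x gam) D = I2 (fun z => (\1_D z * (phi z.1 * phi z.2))%:E).
Proof.
move=> mD; rewrite -[D in LHS]setIT -(integral_indic (gam \x gam) measurableT mD).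
have m1 : measurable_fun setT (fun z : R * R => (\1_D z : R)%:E).
  by apply/measurable_EFinP; exact: measurable_indic.
have p0 := normal_pdf_ge0 0 sigma.
rewrite (@fubini_tonelli1 _ _ _ _ _ gam gam _ m1) //.
rewrite ge0_integral_normal_prob //; first last.
- by move=> x; apply: integral_ge0 => y _; rewrite lee_fin.
- by apply: measurable_fun_fubini_tonelli_F => // z; rewrite lee_fin.
apply: eq_integral => x _; rewrite /fubini_F.
have mx : measurable_fun setT (fun y => (\1_D (x, y) : R)%:E).
  exact: (measurableT_comp m1 (pair1_measurable x)).
rewrite ge0_integral_normal_prob //.
rewrite -ge0_integralZr ?lee_fin //; first last.
- by move=> y _; rewrite -EFinM lee_fin mulr_ge0.
- by apply: emeasurable_funM => //; apply/measurable_EFinP; exact: measurable_normal_pdf.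
by apply: eq_integral => y _; rewrite -!EFinM; congr EFin => /=; ring.
Qed.

Lemma normal_pdf2_rot c s x y : (c ^+ 2 + s ^+ 2 = 1)%R ->
  (phi (rot2 c s (x, y)).1 * phi (rot2 c s (x, y)).2 = phi x * phi y)%R.
Proof.
move=> cs1; rewrite !(normal_pdfE 0 sigma0) /normal_fun /rot2 /= !subr0.
move: (normal_peak sigma) (sigma ^+ 2 *+ 2)%R => k v.
move E : (expR : R -> R) => e; have eD a b : (e (a + b) = e a * e b)%R by rewrite -E expRD.
rewrite [LHS]mulrACA [RHS]mulrACA -!eD -!mulrDl; congr (_ * e (_ / _))%R.
transitivity (- ((c ^+ 2 + s ^+ 2) * (x ^+ 2 + y ^+ 2)))%R; first by ring.
by rewrite cs1; ring.
Qed.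

Lemma normal_prob2_rot c s (D : set (R * R)) : (c ^+ 2 + s ^+ 2 = 1)%R -> (c != -1)%R ->
  measurable D -> (gam \x gam) (rot2 c s @^-1` D) = (gam \x gam) D.
Proof.
move=> cs1 cN1 mD.
have mR : measurable (rot2 c s @^-1` D).
  by rewrite -[X in measurable X]setTI; exact: measurable_rot2.
pose g z : \bar R := (\1_D z * (phi z.1 * phi z.2))%:E.
have mg : measurable_fun setT g.
  by apply/measurable_EFinP; apply: measurable_funM; [exact: measurable_indic|exact: measurable_phi2].
have g0 z : 0 <= g z by rewrite lee_fin !mulr_ge0 ?normal_pdf_ge0.
apply: (etrans (normal_prob2E mR)); apply: (etrans _ (esym (normal_prob2E mD))).
apply: (etrans _ (ge0_integral_rot2 cs1 cN1 mg g0)); congr I2; apply/funext => -[x y].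
by rewrite /g normal_pdf2_rot // !indicE.
Qed.
End PlaneRotation.

(** * Gaussian random matrices *)

Section MatrixBoxes.
Context {R : realType}.
Local Open Scope ereal_scope.

Definition mxbox p q (A : 'I_p -> 'I_q -> set R) : set 'M[R]_(p, q) :=
  [set M | forall i j, A i j (M i j)].

(** Boxes are closed under intersection and generate the sigma-algebra used on matrices, so a law is
    determined by exactly the probabilities that [iid_gaussian] prescribes. *)
Definition mx_boxes p q : set (set 'M[R]_(p, q)) :=
  [set B | exists2 A : 'I_p -> 'I_q -> set R, (forall i j, measurable (A i j)) & B = mxbox A].
Arguments mx_boxes : clear implicits.

Local Notation mxB p q := (g_sigma_algebraType (mx_boxes p q)).

Lemma mxboxE p q (A : 'I_p -> 'I_q -> set R) :
  mxbox A = \bigcap_(k : 'I_p * 'I_q) [set M | A k.1 k.2 (M k.1 k.2)].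
Proof. by apply/seteqP; split => M h; [move=> [i j] _; exact: h|move=> i j; exact: (h (i, j) I)]. Qed.

Lemma measurable_mxP d (T : measurableType d) p q (f : T -> mxB p q) :
  (forall i j, measurable_fun setT (fun w => f w i j)) <-> measurable_fun setT f.
Proof.
split=> [mf|mf i j].
  apply: (@measurability _ _ _ (mxB p q) _ _ (mx_boxes p q)) => //.
  move=> _ [_ [A mA ->] <-]; rewrite setTI mxboxE preimage_bigcap.
  apply: fin_bigcap_measurable => // -[i j] _.
  by rewrite -[X in measurable X]setTI; exact: (mf i j).
suff mc : measurable_fun setT (fun M : mxB p q => M i j) by exact: (measurableT_comp mc mf).
move=> _ B mB; rewrite setTI; apply: sub_sigma_algebra.
exists (fun i' j' => if (i' == i) && (j' == j) then B else setT).
  by move=> i' j'; case: ifP.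
apply/seteqP; split => [M MB i' j'|M /(_ i j)]; last by rewrite !eqxx.
by case: ifP => // /andP[/eqP -> /eqP ->].
Qed.

Lemma measurable_coord p q i j : measurable_fun setT (fun M : mxB p q => M i j).
Proof. by apply: (measurable_mxP (fun M : mxB p q => M)).2; exact: measurable_id. Qed.

Lemma mx_boxes_unique p q (m1 m2 : {measure set (mxB p q) -> \bar R}) :
  m1 setT < +oo ->
  (forall A, (forall i j, measurable (A i j)) -> m1 (mxbox A) = m2 (mxbox A)) ->
  forall B, measurable B -> m1 B = m2 B.
Proof.
move=> m1oo m12 B mB.
have T : setT = mxbox (fun (_ : 'I_p) (_ : 'I_q) => [set: R]) by apply/seteqP; split.
apply: (@measure_unique _ R (mxB p q) (mx_boxes p q) (fun=> setT) _ _ _ _ m1 m2) => //.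
- move=> _ _ [A mA ->] [A' mA' ->]; exists (fun i j => A i j `&` A' i j).
    by move=> i j; exact: measurableI.
  by apply/seteqP; split=> [M [h h'] i j|M h]; [split|split=> i j; have [] := h i j].
- by move=> _; rewrite T; exists (fun _ _ => setT).
- by rewrite bigcup_const //; exists 0%N.
by move=> _ [A mA ->]; exact: m12.
Qed.
End MatrixBoxes.
Arguments mx_boxes : clear implicits.
Notation mxB R p q := (g_sigma_algebraType (mx_boxes R p q)).

Section Iid.
Context {R : realType} (v : R).
Local Open Scope ereal_scope.
Local Notation gam := (normal_prob 0 (Num.sqrt v)).

(** The marginal laws are the boxes with a single constrained entry, so every closure property below
    reduces to one computation on boxes. *)
Lemma iid_box d (T : measurableType d) (P : probability T R) p q (M : T -> 'M[R]_(p, q)) :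
  iid_gaussian P M v <->
  (forall i j, measurable_fun setT (fun w => M w i j)) /\
  forall A : 'I_p -> 'I_q -> set R, (forall i j, measurable (A i j)) ->
    P [set w | mxbox A (M w)] = \big[*%E/1]_(k : 'I_p * 'I_q) gam (A k.1 k.2).
Proof.
split=> [[mM gM bM]|[mM bM]].
  by split=> // A mA; rewrite [LHS]bM //; apply: eq_bigr => k _; exact: gM.
have gM i j (A : set R) : measurable A -> P ((fun w => M w i j) @^-1` A) = gam A.
  move=> mA; pose A' i' j' := if ((i', j') == (i, j)) then A else setT.
  have -> : (fun w => M w i j) @^-1` A = [set w | mxbox A' (M w)].
    apply/seteqP; split => w /= h; last by have := h i j; rewrite /A' eqxx.
    by move=> i' j'; rewrite /A'; case: eqP => // -[-> ->].
  rewrite bM; last by move=> i' j'; rewrite /A'; case: ifP.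
  rewrite (bigD1 (i, j)) //= /A' eqxx big1 ?mule1 // => -[i' j'] /negbTE /= ->.
  exact: probability_setT.
split=> // A mA; rewrite [LHS]bM //; apply: eq_bigr => k _; exact/esym/gM.
Qed.

Lemma iid_measurable d (T : measurableType d) (P : probability T R) p q (M : T -> 'M[R]_(p, q)) :
  iid_gaussian P M v -> measurable_fun setT (M : T -> mxB R p q).
Proof. by case=> mM _ _; exact/measurable_mxP. Qed.

Section Law.
Context d1 d2 (T1 : measurableType d1) (T2 : measurableType d2)
  (P1 : probability T1 R) (P2 : probability T2 R) (p q : nat)
  (M1 : T1 -> 'M[R]_(p, q)) (M2 : T2 -> 'M[R]_(p, q)).
Hypotheses (i1 : iid_gaussian P1 M1 v) (i2 : iid_gaussian P2 M2 v).

Lemma iid_law (B : set (mxB R p q)) : measurable B -> P1 (M1 @^-1` B) = P2 (M2 @^-1` B).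
Proof.
have m1 := iid_measurable i1; have m2 := iid_measurable i2.
move=> mB; have := @mx_boxes_unique R p q (pushforward P1 (M1 : T1 -> mxB R p q)).
move=> /(_ m1) U; have := U (pushforward P2 (M2 : T2 -> mxB R p q)).
move=> /(_ m2); apply => //; first by rewrite /= /pushforward preimage_setT probability_setT ltry.
move=> A mA; apply: (etrans (((iid_box _ _).1 i1).2 A mA)).
exact: (esym (((iid_box _ _).1 i2).2 A mA)).
Qed.

Lemma iid_ge0_integral (f : mxB R p q -> \bar R) : measurable_fun setT f ->
  (forall M, 0 <= f M) -> \int[P1]_w f (M1 w) = \int[P2]_w f (M2 w).
Proof.
move=> mf f0; have m1 := iid_measurable i1; have m2 := iid_measurable i2.
rewrite -[LHS](@ge0_integral_pushforward _ _ _ _ _ _ m1 P1 setT) //.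
rewrite -[RHS](@ge0_integral_pushforward _ _ _ _ _ _ m2 P2 setT) //.
by apply: eq_measure_integral => B mB _; exact: iid_law.
Qed.

Lemma iid_integral (f : mxB R p q -> R) : measurable_fun setT f ->
  \int[P1]_w (f (M1 w))%:E = \int[P2]_w (f (M2 w))%:E.
Proof.
move=> mf; rewrite integralE [RHS]integralE.
have mE : measurable_fun setT (EFin \o f) by exact/measurable_EFinP.
have mp := measurable_funepos mE; have mn := measurable_funeneg mE.
congr (_ - _).
  transitivity (\int[P1]_w (EFin \o f)^\+ (M1 w)).
    by apply: eq_integral => w _; rewrite !funeposE.
  rewrite (iid_ge0_integral mp (fun x => funepos_ge0 _ x)).
  by apply: eq_integral => w _; rewrite !funeposE.
transitivity (\int[P1]_w (EFin \o f)^\- (M1 w)).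
  by apply: eq_integral => w _; rewrite !funenegE.
rewrite (iid_ge0_integral mn (fun x => funeneg_ge0 _ x)).
by apply: eq_integral => w _; rewrite !funenegE.
Qed.
End Law.
End Iid.

Section IidClosure.
Context {R : realType} (v : R).
Local Open Scope ereal_scope.
Local Notation gam := (normal_prob 0 (Num.sqrt v)).

Lemma iid_rowsel d (T : measurableType d) (P : probability T R) p p' q
    (M : T -> 'M[R]_(p, q)) (h : 'I_p' -> 'I_p) : injective h -> iid_gaussian P M v ->
  iid_gaussian P (fun w => \matrix_(i, j) M w (h i) j) v.
Proof.
move=> hI /iid_box[mM bM]; apply/iid_box; split=> [i j|A mA].
  by under eq_fun do rewrite mxE; exact: mM.
(* Rows outside the image of [h] are unconstrained and contribute a factor 1. *)
pose A' k j := if [pick i | h i == k] is Some i then A i j else setT.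
have A'h i j : A' (h i) j = A i j.
  by rewrite /A'; case: pickP => [i' /eqP/hI -> //|/(_ i)]; rewrite eqxx.
have -> : [set w | mxbox A (\matrix_(i, j) M w (h i) j)] = [set w | mxbox A' (M w)].
  apply/seteqP; split=> w /= H k j; last by rewrite mxE -A'h; exact: H.
  by rewrite /A'; case: pickP => // i /eqP <-; have := H i j; rewrite mxE.
rewrite bM; last by move=> k j; rewrite /A'; case: pickP.
rewrite -(pair_bigA _ (fun k j => gam (A' k j))) -(pair_bigA _ (fun k j => gam (A k j))) /=.
rewrite (bigID (mem [set h i | i in 'I_p']%SET)) /= [X in _ * X]big1 ?mule1; last first.
  move=> k kh; apply: big1 => j _; rewrite /A'; case: pickP => [i /eqP e|_].
    by move: kh; rewrite -e imset_f.
  exact: probability_setT.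
rewrite big_imset /=; last by move=> ? ? _ _; exact: hI.
by apply: eq_bigr => i _; apply: eq_bigr => j _; rewrite A'h.
Qed.

Lemma iid_flip d (T : measurableType d) (P : probability T R) p q
    (M : T -> 'M[R]_(p, q)) (b : 'I_p) : v != 0%R -> (0 <= v)%R -> iid_gaussian P M v ->
  iid_gaussian P (fun w => flip R b *m M w) v.
Proof.
move=> v0 v1 /iid_box[mM bM]; apply/iid_box; split=> [i j|A mA].
  by under eq_fun do rewrite flip_mulE; apply: measurable_funM.
have mN (B : set R) : measurable B -> measurable (-%R @^-1` B).
  by move=> mB; rewrite -[X in measurable X]setTI; exact: oppr_measurable.
pose A' i j := if i == b then -%R @^-1` A i j else A i j.
have -> : [set w | mxbox A (flip R b *m M w)] = [set w | mxbox A' (M w)].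
  apply/seteqP; split=> w /= H i j; have := H i j; rewrite flip_mulE /A';
    by case: ifP => _ /=; rewrite ?expr1 ?mulN1r ?expr0 ?mul1r.
rewrite bM; last by move=> i j; rewrite /A'; case: ifP => // _; exact: mN.
apply: eq_bigr => -[i j] _ /=; rewrite /A'; case: ifP => // _.
by rewrite normal_probN // sqrtr_eq0 -ltNge lt_neqAle eq_sym v0.
Qed.

Definition merge_mx p q (S : 'I_p -> 'I_q -> bool) (M N : 'M[R]_(p, q)) : 'M[R]_(p, q) :=
  \matrix_(i, j) if S i j then N i j else M i j.

Lemma mxbox_merge p q (S : 'I_p -> 'I_q -> bool) (A : 'I_p -> 'I_q -> set R) (M N : 'M[R]_(p, q)) :
  mxbox A (merge_mx S M N) <->
  mxbox (fun i j => if S i j then setT else A i j) M /\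
  mxbox (fun i j => if S i j then A i j else setT) N.
Proof.
split=> [H|[H1 H2] i j].
  by split=> i j; have := H i j; rewrite mxE; case: ifP.
by have := H1 i j; have := H2 i j; rewrite mxE; case: ifP.
Qed.

(* Resampling the entries selected by [S] from an independent copy does not change the law. *)
Lemma iid_merge d1 d2 (T1 : measurableType d1) (T2 : measurableType d2)
  (P1 : probability T1 R) (P2 : probability T2 R) p q
  (M1 : T1 -> 'M[R]_(p, q)) (M2 : T2 -> 'M[R]_(p, q)) S :
  iid_gaussian P1 M1 v -> iid_gaussian P2 M2 v ->
  iid_gaussian (P1 \x P2) (fun z => merge_mx S (M1 z.1) (M2 z.2)) v.
Proof.
move=> /iid_box[m1 b1] /iid_box[m2 b2]; apply/iid_box; split=> [i j|A mA].
  under eq_fun do rewrite mxE; case: (S i j).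
    exact: (measurableT_comp (m2 i j) measurable_snd).
  exact: (measurableT_comp (m1 i j) measurable_fst).
pose A1 i j := if S i j then setT else A i j.
pose A2 i j := if S i j then A i j else setT.
have mA1 i j : measurable (A1 i j) by rewrite /A1; case: ifP.
have mA2 i j : measurable (A2 i j) by rewrite /A2; case: ifP.
have mbox d' (T' : measurableType d') (M : T' -> 'M[R]_(p, q)) B :
    (forall i j, measurable_fun setT (fun w => M w i j)) -> (forall i j, measurable (B i j)) ->
    measurable [set w | mxbox B (M w)].
  move=> mM mB; rewrite -[X in measurable X]setTI.
  apply: ((measurable_mxP (M : T' -> mxB R p q)).1 mM) => //.
  by apply: sub_sigma_algebra; exists B.
have -> : [set z | mxbox A (merge_mx S (M1 z.1) (M2 z.2))] =
    [set w | mxbox A1 (M1 w)] `*` [set w | mxbox A2 (M2 w)].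
  by apply/seteqP; split=> -[w w'] /= /mxbox_merge.
apply: (etrans (product_measure1E P1 P2 (mbox _ _ _ _ m1 mA1) (mbox _ _ _ _ m2 mA2))).
apply: (etrans (f_equal2 *%E (b1 _ mA1) (b2 _ mA2))); rewrite -big_split; apply: eq_bigr => -[i j] _ /=.
by rewrite /A1 /A2; case: ifP => _; rewrite probability_setT ?mule1 ?mul1e.
Qed.

(** Rectangles determine the joint law, and a rectangle is a box leaving all other entries free. *)
Lemma iid_pair d (T : measurableType d) (P : probability T R) p q
    (M : T -> 'M[R]_(p, q)) a b (k : 'I_q) (D : set (R * R)) : a != b ->
  iid_gaussian P M v -> measurable D ->
  P [set w | D (M w a k, M w b k)] = (gam \x gam) D.
Proof.
move=> ab iM mD; have [mM gM bM] := iM.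
pose f w : measurableTypeR R * measurableTypeR R := (M w a k, M w b k).
have mf : measurable_fun setT f.
  by apply/measurable_fun_pairP; split; exact: mM.
have U := @product_measure_unique _ _ _ _ R gam gam (pushforward P f).
apply/esym; apply: (U mf) mD => A B mA mB /=.
pose A' i (j : 'I_q) := if j == k then (if i == a then A else if i == b then B else setT) else setT.
have ba : (b == a) = false by rewrite eq_sym (negbTE ab).
transitivity (P [set w | mxbox A' (M w)]).
  rewrite /pushforward; congr (P _); apply/seteqP; split => w /= => [[hA hB] i j|H].
    by rewrite /A'; case: eqP => // ->; case: eqP => [->|_] //; case: eqP => [->|].
  by have := H a k; have := H b k; rewrite /A' !eqxx ba.
have [_ ->] := (iid_box _ _ _).1 iM; last first.
  by move=> i j; rewrite /A'; case: ifP => // _; case: ifP => // _; case: ifP.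
rewrite (bigD1 (a, k)) //= (bigD1 (b, k)) /=; last by rewrite xpair_eqE ba.
rewrite /A' !eqxx ba big1 ?mule1 // => -[i j] /= /andP[].
rewrite !xpair_eqE; case: (j == k); rewrite ?andbT ?andbF => ia ib.
  by rewrite (negbTE ia) (negbTE ib) probability_setT.
exact: probability_setT.
Qed.
End IidClosure.

Section IidRotation.
Context {R : realType} (v : R).
Hypothesis v0 : 0 < v.
Local Open Scope ereal_scope.
Local Notation gam := (normal_prob 0 (Num.sqrt v)).
Context d (T : measurableType d) (P : probability T R) (p q : nat) (a b : 'I_p).
Hypothesis ab : a != b.

(** Restricting the rotation to the columns in [J] allows invariance to be proved one column at a
    time. *)
Definition givens_cols (J : pred 'I_q) (c s : R) (M : 'M[R]_(p, q)) : 'M[R]_(p, q) :=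
  \matrix_(i, j) if J j then (givens a b c s *m M) i j else M i j.

Lemma measurable_givens_cols J c s (M : T -> 'M[R]_(p, q)) :
  (forall i j, measurable_fun setT (fun w => M w i j)) ->
  forall i j, measurable_fun setT (fun w => givens_cols J c s (M w) i j).
Proof.
move=> mM i j; under eq_fun do rewrite mxE; case: (J j); last exact: mM.
under eq_fun do rewrite givens_mulE.
case: (i == a); last (case: (i == b); last exact: mM).
  by apply: measurable_funD; apply: measurable_funM.
by apply: measurable_funB; apply: measurable_funM.
Qed.

(** The two entries being rotated are resampled from an independent copy; on the product space the
    event becomes a rectangle, one side constraining the other entries and the other side a planar
    event. *)
Lemma prob_givens_col (M : T -> 'M[R]_(p, q)) k c s (A : 'I_p -> 'I_q -> set R) :
  iid_gaussian P M v -> (forall i j, measurable (A i j)) ->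
  P [set w | mxbox A (givens_cols (pred1 k) c s (M w))] =
  P [set w | mxbox (fun i j => if (j == k) && ((i == a) || (i == b)) then setT else A i j) (M w)] *
  (gam \x gam) (rot2 c s @^-1` (A a k `*` A b k)).
Proof.
move=> iM mA; pose S i j := (j == k) && ((i == a) || (i == b)).
have [mM _ _] := iM.
pose B : set (mxB R p q) := [set N | mxbox A (givens_cols (pred1 k) c s N)].
have mB : measurable B.
  rewrite -[X in measurable X]setTI.
  have mg : measurable_fun setT (givens_cols (pred1 k) c s : mxB R p q -> mxB R p q).
    apply/measurable_mxP => i j; under eq_fun do rewrite mxE; case: (pred1 k j); last exact: measurable_coord.
    under eq_fun do rewrite givens_mulE.
    case: (i == a); last (case: (i == b); last exact: measurable_coord).
      by apply: measurable_funD; apply: measurable_funM => //; exact: measurable_coord.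
    by apply: measurable_funB; apply: measurable_funM => //; exact: measurable_coord.
  by apply: (mg measurableT); apply: sub_sigma_algebra; exists A.
have := iid_law iM (iid_merge S iM iM) mB => ->.
pose D := rot2 c s @^-1` (A a k `*` A b k).
have mD : measurable D.
  by rewrite -[X in measurable X]setTI; apply: measurable_rot2 => //; exact: measurableX.
rewrite -(iid_pair k ab iM mD).
pose A1 i j := if S i j then setT else A i j.
have mA1 i j : measurable (A1 i j) by rewrite /A1; case: ifP.
have m1 : measurable [set w | mxbox A1 (M w)].
  rewrite -[X in measurable X]setTI.
  by apply: (iid_measurable iM measurableT); apply: sub_sigma_algebra; exists A1.
have m2 : measurable [set w | D (M w a k, M w b k)].
  rewrite -[X in measurable X]setTI.
  have mf : measurable_fun setT (fun w => (M w a k, M w b k)).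
    by apply/measurable_fun_pairP; split; exact: mM.
  exact: mf.
apply: (etrans _ (product_measure1E P P m1 m2)); congr ((P \x P) _).
have ba : (b == a) = false by rewrite eq_sym (negbTE ab).
have E (N N' : 'M[R]_(p, q)) i j : givens_cols (pred1 k) c s (merge_mx S N N') i j =
    if j == k then if i == a then (rot2 c s (N' a k, N' b k)).1
                   else if i == b then (rot2 c s (N' a k, N' b k)).2 else N i j
    else N i j.
  rewrite mxE /= givens_mulE !mxE /S; case: eqP => [->|//].
  by rewrite !eqxx ba; case: (i == a); case: (i == b).
apply/seteqP; split=> -[w w'] /= => [H|[H1 [H2 H3]] i j].
  split; last by split; [have := H a k|have := H b k]; rewrite E !eqxx ?ba.
  move=> i j; have := H i j; rewrite E /A1 /S; case: (j == k) => //=.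
  by case: (i == a); case: (i == b).
rewrite E; have := H1 i j; rewrite /A1 /S; case: eqP => [->|//] /=.
by case: eqP => [->|_] //=; case: eqP => [->|].
Qed.

Lemma iid_givens_col (M : T -> 'M[R]_(p, q)) k c s : (c ^+ 2 + s ^+ 2 = 1)%R -> (c != -1)%R ->
  iid_gaussian P M v -> iid_gaussian P (fun w => givens_cols (pred1 k) c s (M w)) v.
Proof.
move=> cs1 cN1 iM; have [mM _ _] := iM; have [_ bM] := (iid_box _ _ _).1 iM.
apply/iid_box; split=> [i j|A mA]; first exact: measurable_givens_cols.
have s0 : Num.sqrt v != 0%R by rewrite sqrtr_eq0 -ltNge.
have mAB : measurable (A a k `*` A b k) by exact: measurableX.
apply: (etrans (prob_givens_col k c s iM mA)).
apply: (etrans (f_equal2 *%E erefl (normal_prob2_rot s0 cs1 cN1 mAB))).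
apply: (etrans _ (bM A mA)).
(* The angle 0 puts the unrotated box in the same product form, so only the planar factors remain to
   be compared. *)
have -> : [set w | mxbox A (M w)] = [set w | mxbox A (givens_cols (pred1 k) 1 0 (M w))].
  suff E N : givens_cols (pred1 k) 1 0 N = N by apply/seteqP; split => w /=; rewrite E.
  apply/matrixP => i j; rewrite mxE givens_mulE; case: ifP => // _.
  by case: eqP => [->|_]; [|case: eqP => [->|//]]; rewrite !mul0r mul1r ?addr0 ?subr0.
have e : rot2 1 0 @^-1` (A a k `*` A b k) = A a k `*` A b k.
  by apply/seteqP; split=> -[x y] /=; rewrite !mul1r !mul0r addr0 subr0.
have := prob_givens_col k 1 0 iM mA; rewrite e; exact: esym.
Qed.

Lemma iid_givens (M : T -> 'M[R]_(p, q)) c s : (c ^+ 2 + s ^+ 2 = 1)%R -> (c != -1)%R ->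
  iid_gaussian P M v -> iid_gaussian P (fun w => givens a b c s *m M w) v.
Proof.
move=> cs1 cN1 iM.
(* Induction on the number of leading columns already rotated; past [q] nothing changes. *)
suff H n : iid_gaussian P (fun w => givens_cols (fun j => (j < n)%N) c s (M w)) v.
  have := H q; congr (iid_gaussian P _ v); apply/funext => w; apply/matrixP => i j.
  by rewrite mxE ltn_ord.
elim: n => [|n IHn].
  move: iM; congr (iid_gaussian P _ v); apply/funext => w; apply/matrixP => i j.
  by rewrite mxE.
have [nq|qn] := ltnP n q; last first.
  move: IHn; congr (iid_gaussian P _ v); apply/funext => w; apply/matrixP => i j.
  by rewrite !mxE (leq_trans (ltn_ord j) qn) ltnS (ltnW (leq_trans (ltn_ord j) qn)).
have := iid_givens_col (Ordinal nq) cs1 cN1 IHn.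
congr (iid_gaussian P _ v); apply/funext => w; apply/matrixP => i j.
rewrite [LHS]mxE [RHS]mxE /= -val_eqE /= ltnS leq_eqVlt !givens_mulE.
rewrite ![givens_cols _ _ _ _ _ _]mxE !givens_mulE.
by case: eqP => [->|_] /=; rewrite ?ltnn.
Qed.
End IidRotation.

(** * Measurability of the polar factor and almost sure full rank *)

Section MeasurableMatrix.
Context {R : realType} d (T : measurableType d).

Lemma measurable_mulmx p q k (A : T -> 'M[R]_(p, q)) (B : T -> 'M[R]_(q, k)) :
  (forall i j, measurable_fun setT (fun w => A w i j)) ->
  (forall i j, measurable_fun setT (fun w => B w i j)) ->
  forall i j, measurable_fun setT (fun w => (A w *m B w) i j).
Proof.
move=> mA mB i j; under eq_fun do rewrite mxE.
by apply: measurable_sum => l; apply: measurable_funM.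
Qed.

Lemma measurable_trmx p q (A : T -> 'M[R]_(p, q)) :
  (forall i j, measurable_fun setT (fun w => A w i j)) ->
  forall i j, measurable_fun setT (fun w => (A w)^T i j).
Proof. by move=> mA i j; under eq_fun do rewrite mxE; exact: mA. Qed.

Lemma measurable_det k (A : T -> 'M[R]_k) :
  (forall i j, measurable_fun setT (fun w => A w i j)) ->
  measurable_fun setT (fun w => \det (A w)).
Proof.
move=> mA; apply: measurable_sum => s.
by apply: measurable_funM => //; apply: measurable_prod => i _; exact: mA.
Qed.

Lemma measurable_polar_ns p q (A : T -> 'M[R]_(p, q)) :
  (forall i j, measurable_fun setT (fun w => A w i j)) ->
  forall i j, measurable_fun setT (fun w => polar_ns (A w) i j).
Proof.
move=> mA i j; apply: (measurable_fun_cvg (h := fun k w => ns_iter (A w) k i j)); last first.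
  move=> w _; have [l [W sd]] := gram_spectral_data (A w).
  by rewrite (polar_nsE sd); exact: ns_iter_cvg.
move=> k; elim: k i j => [|k IHk] i j.
  rewrite /ns_iter /=; under eq_fun do rewrite mxE; apply: measurable_funM => //.
  (* The quantity is positive, so its inverse is exp(-ln), a composition of measurable functions. *)
  have -> : (fun w => (1 + \tr (A w *m (A w)^T))^-1) =
      fun w => expR (- ln (1 + \tr (A w *m (A w)^T))).
    by apply/funext => w; rewrite expRN lnK // posrE ltr_pwDl // tr_gram_ge0.
  apply: (measurableT_comp (@measurable_expR R)); apply: measurableT_comp => //.
  apply: (measurableT_comp (@measurable_ln R)); apply: measurable_funD => //.
  apply: measurable_sum => a; apply: measurable_mulmx => //; exact: measurable_trmx.
have -> : (fun w => ns_iter (A w) k.+1 i j) = fun w => 3 / 2 * ns_iter (A w) k i j -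
    2^-1 * (ns_iter (A w) k *m (ns_iter (A w) k)^T *m ns_iter (A w) k) i j.
  apply/funext => w; rewrite /ns_iter iterS -/(ns_iter _ _) /ns_step.
  by move: (ns_iter _ _) => Y; rewrite mxE [in X in _ + X]mxE; congr (_ - _); rewrite mxE.
apply: measurable_funB; apply: measurable_funM => //.
apply: measurable_mulmx => //; apply: measurable_mulmx => //; exact: measurable_trmx.
Qed.
End MeasurableMatrix.

Section FullRank.
Context {R : realType} (v : R).

(** [inord] returns the intended index only below the bound, so this is the leading minor for k at
    most both dimensions. *)
Definition lead_mx p q k (M : 'M[R]_(p.+1, q.+1)) : 'M[R]_k :=
  \matrix_(i, j) M (inord i) (inord j).

Lemma det_last_row k (A B : 'M[R]_k.+1) : (forall i j, i != ord_max -> A i j = B i j) ->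
  \det A = \sum_j A ord_max j * cofactor B ord_max j.
Proof.
move=> AB; rewrite (expand_det_row _ ord_max); apply: eq_bigr => j _; congr (_ * _).
congr (_ * \det _); apply/matrixP => a b; rewrite !mxE; apply: AB.
by rewrite eq_sym neq_lift.
Qed.

(** The determinant is affine in its corner entry, with the next smaller leading minor as slope.
    Given a nonzero slope, a single value of the corner is bad, and an independent Gaussian avoids
    it almost surely. *)
Lemma iid_lead_det_neq0 d (T : measurableType d) (P : probability T R) p q
    (M : T -> 'M[R]_(p.+1, q.+1)) k : (k <= p.+1)%N -> (k <= q.+1)%N ->
  iid_gaussian P M v -> P [set w | \det (lead_mx k (M w)) = 0] = 0%E.
Proof.
move=> + + iM; have [mM gM _] := iM.
elim: k => [_ _|k IHk kp kq].
  rewrite (_ : [set _ | _] = set0) ?measure0 //; apply/seteqP; split => w //=.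
  by rewrite det_mx00 => /eqP; rewrite oner_eq0.
have {}IHk := IHk (ltnW kp) (ltnW kq).
pose e : 'I_p.+1 := inord k; pose f : 'I_q.+1 := inord k.
pose S i j := (i == e) && (j == f).
pose B : set (mxB R p.+1 q.+1) := [set N | \det (lead_mx k.+1 N) = 0].
have mdet k' : measurable_fun setT (fun N : mxB R p.+1 q.+1 => \det (lead_mx k' N)).
  by apply: measurable_det => i j; under eq_fun do rewrite mxE; exact: measurable_coord.
have mB : measurable B.
  by rewrite -[B]setTI; exact: (mdet k.+1 measurableT _ (measurable_set1 0)).
have := iid_law iM (iid_merge S iM iM) mB => ->.
(* The part of the expansion along the last row that does not involve the corner. *)
pose b (N : 'M[R]_(p.+1, q.+1)) := \sum_(j < k.+1 | j != ord_max) lead_mx k.+1 N ord_max j * cofactor (lead_mx k.+1 N) ord_max j.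
have detE N N' : \det (lead_mx k.+1 (merge_mx S N N')) = N' e f * \det (lead_mx k N) + b N.
  rewrite (@det_last_row _ _ (lead_mx k.+1 N)); last first.
    move=> i j im; rewrite !mxE /S (_ : (inord i == e) = false) //; apply/eqP => /(congr1 val).
    rewrite /= !inordK //; first by move/eqP; apply/negP; move: im; rewrite -val_eqE.
    exact: leq_trans (ltn_ord i) kp.
  rewrite (bigD1 ord_max) //=; congr (_ + _).
    rewrite !mxE /S !eqxx /cofactor -signr_odd addnn odd_double expr0 mul1r.
    congr (_ * \det _); apply/matrixP => i j; rewrite !mxE.
    have lm n (x : 'I_k) : (k <= n)%N -> inord (lift ord_max x) = inord x :> 'I_n.+1.
      move=> kn; apply: val_inj; have xn : (x < n.+1)%N by rewrite ltnS ltnW // (leq_trans (ltn_ord x)).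
      by rewrite lift_max /= !inordK.
    by rewrite !lm.
  apply: eq_bigr => j jm; congr (_ * _); rewrite !mxE /S eqxx /= (_ : (inord j == f) = false) //.
  apply/eqP => /(congr1 val); rewrite /= !inordK //; last exact: leq_trans (ltn_ord j) kq.
  by move/eqP; apply/negP; move: jm; rewrite -val_eqE.
set D := (X in _ X = _).
have mD : measurable D.
  rewrite -[D]setTI; apply: (iid_measurable (iid_merge S iM iM) measurableT mB).
transitivity (\int[P]_w P (xsection D w))%E; first by [].
have mF := measurable_fun_xsection P mD.
have mN : measurable [set w | \det (lead_mx k (M w)) = 0].
  rewrite -[X in measurable X]setTI.
  have m1 : measurable_fun setT (fun w => \det (lead_mx k (M w))).
    by apply: measurable_det => i j; under eq_fun do rewrite mxE; exact: mM.
  exact: (m1 measurableT _ (measurable_set1 0)).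
(* By induction the samples with zero slope form a null set; elsewhere the section over the
   resampled corner is one point. *)
rewrite (ge0_negligible_integral mN measurableT mF _ IHk) //.
rewrite (eq_integral (cst 0%E)) ?integral0 // => w; rewrite inE => -[_ /= /eqP Dw].
have -> : xsection D w = (fun w' => M w' e f) @^-1` [set - b (M w) / \det (lead_mx k (M w))].
  apply/seteqP; split => w'; rewrite /xsection /= inE /D /B /= detE => h.
    by apply: (mulIf Dw); rewrite divfK //; apply/eqP; rewrite -addr_eq0 h.
  by rewrite h divfK // addNr.
rewrite gM; last exact: measurable_set1.
exact: normal_prob1.
Qed.

(** If u M M^T = 0 then u M = 0, so a singular Gram matrix makes the leading square minor
    singular. *)
Lemma iid_gram_det_neq0 d (T : measurableType d) (P : probability T R) p q
    (M : T -> 'M[R]_(p.+1, q.+1)) : (p <= q)%N -> iid_gaussian P M v ->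
  P [set w | \det (M w *m (M w)^T) = 0] = 0%E.
Proof.
move=> pq iM; apply/eqP; rewrite eq_le measure_ge0 andbT.
have [mM _ _] := iM.
rewrite -(iid_lead_det_neq0 (leqnn p.+1) _ iM) //.
apply: le_measure; rewrite ?inE.
- rewrite -[X in measurable X]setTI.
  have m1 : measurable_fun setT (fun w => \det (M w *m (M w)^T)).
    by apply: measurable_det; apply: measurable_mulmx => //; exact: measurable_trmx.
  exact: (m1 measurableT _ (measurable_set1 0)).
- rewrite -[X in measurable X]setTI.
  have m1 : measurable_fun setT (fun w => \det (lead_mx p.+1 (M w))).
    by apply: measurable_det => i j; under eq_fun do rewrite mxE; exact: mM.
  exact: (m1 measurableT _ (measurable_set1 0)).
move=> w /= /eqP/det0P[u u0 uG]; apply/eqP/det0P.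
exists u => //.
have uM : u *m M w = 0.
  apply: trmx_inj; rewrite trmx0; apply: sum_sqr_eq0.
  rewrite trmx_mul -quad_gram trmxK.
  by rewrite uG mul0mx mxE.
apply/rowP => j; rewrite [RHS]mxE; transitivity ((u *m M w) 0 (inord j)); last by rewrite uM mxE.
by rewrite [LHS]mxE [RHS]mxE; apply: eq_bigr => i _; rewrite mxE inord_val.
Qed.
End FullRank.

(** * Moments *)

Section GaussianMoment.
Context {R : realType} (sigma : R).
Hypothesis sigma0 : 0 < sigma.
Local Notation mu := (@lebesgue_measure R).
Local Open Scope ereal_scope.

(* [1 + t x^2 <= e^(t x^2)], and [e^(t x^2)] times the density of variance [sigma^2] is,
   up to the factor [1 + e], the density of variance [(sigma (1 + e))^2]. *)
Lemma normal_second_moment_le : \int[normal_prob 0 sigma]_x (x ^+ 2)%:E <= (sigma ^+ 2)%:E.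
Proof.
suff H e : (0 < e)%R -> \int[normal_prob 0 sigma]_x (x ^+ 2)%:E <= ((sigma * (1 + e)) ^+ 2)%:E.
  apply/lee_addgt0Pr => _/posnumP[e].
  (* Since t <= 1, (1 + t)^2 <= 1 + 3 t, and the second bound makes 3 t sigma^2 at most e. *)
  pose t := Num.min 1%R (e%:num / (3 * sigma ^+ 2))%R.
  have s2 : (0 < sigma ^+ 2)%R by rewrite exprn_gt0.
  have t0 : (0 < t)%R by rewrite lt_min ltr01 /= divr_gt0 // mulr_gt0.
  apply: (le_trans (H _ t0)); rewrite -EFinD lee_fin.
  have t1 : (t <= 1)%R by rewrite ge_min lexx.
  have t2 : (t * (3 * sigma ^+ 2) <= e%:num)%R.
    by rewrite -ler_pdivlMr ?mulr_gt0 // ge_min lexx orbT.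
  rewrite exprMn; nra.
move=> e0; set sigma' := (sigma * (1 + e))%R.
have s0 : sigma != 0%R by rewrite gt_eqF.
have e1 : (0 < 1 + e)%R by rewrite ltr_pwDl // ltW.
have s'0 : sigma' != 0%R by rewrite mulf_neq0 // gt_eqF.
pose t := ((sigma ^+ 2 *+ 2)^-1 - (sigma' ^+ 2 *+ 2)^-1)%R.
have pE x : (expR (t * x ^+ 2) * normal_pdf 0 sigma x = (1 + e) * normal_pdf 0 sigma' x)%R.
  rewrite !normal_pdfE // /normal_fun /normal_peak !subr0.
  have -> : Num.sqrt (sigma' ^+ 2 * pi *+ 2) = ((1 + e) * Num.sqrt (sigma ^+ 2 * pi *+ 2))%R.
    rewrite -{1}(gtr0_norm e1) -sqrtr_sqr -sqrtrM ?sqr_ge0 //; congr Num.sqrt.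
    by rewrite /sigma'; ring.
  have -> : (- x ^+ 2 / (sigma' ^+ 2 *+ 2) = t * x ^+ 2 + - x ^+ 2 / (sigma ^+ 2 *+ 2))%R.
    by rewrite /t; field; rewrite s0.
  rewrite expRD invfM; move: (expR _) (expR _) ((Num.sqrt _)^-1)%R => E1 E2 S.
  by rewrite !mulrA mulfV ?gt_eqF //; ring.
have mphi s : measurable_fun setT (EFin \o normal_pdf (0 : R) s).
  by apply/measurable_EFinP; exact: measurable_normal_pdf.
have t0 : (0 < t)%R.
  have a0 : (0 < sigma ^+ 2 *+ 2)%R by rewrite pmulrn_lgt0 // exprn_gt0.
  have ab : (sigma ^+ 2 *+ 2 < sigma' ^+ 2 *+ 2)%R.
    by rewrite ltr_pMn2r // /sigma' exprMn ltr_pMr ?exprn_gt0 // exprn_egt1 // ltrDl.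
  by rewrite subr_gt0 ltf_pV2 // posrE // (lt_trans a0).
have m2 : measurable_fun setT (fun x : R => (x ^+ 2)%:E).
  by apply/measurable_EFinP; exact: exprn_measurable.
have q1 x : (0 <= t * (x ^+ 2 * normal_pdf 0 sigma x))%R.
  by apply: mulr_ge0; [exact: ltW|apply: mulr_ge0; [exact: sqr_ge0|exact: normal_pdf_ge0]].
have mI : measurable_fun setT (fun x : R => (x ^+ 2)%:E * (normal_pdf 0 sigma x)%:E).
  by apply: emeasurable_funM => //; exact: mphi.
have mtI : measurable_fun setT (fun x : R => t%:E * ((x ^+ 2)%:E * (normal_pdf 0 sigma x)%:E)).
  exact: emeasurable_funM.
have n0 s x := normal_pdf_ge0 (0 : R) s x.
rewrite ge0_integral_normal_prob //; last by move=> x; rewrite lee_fin sqr_ge0.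
set I := integral _ _ _.
have : t%:E * I + 1 <= (1 + e)%:E.
  rewrite -(integral_normal_pdf 0 sigma) -[leRHS]mule1 -(integral_normal_pdf 0 sigma').
  have E1 : t%:E * I = \int[mu]_x (t%:E * ((x ^+ 2)%:E * (normal_pdf 0 sigma x)%:E)).
    rewrite ge0_integralZl ?lee_fin ?(ltW t0) // => x _.
    by rewrite -EFinM lee_fin mulr_ge0 // sqr_ge0.
  have E2 : (1 + e)%:E * \int[mu]_x (normal_pdf 0 sigma' x)%:E =
      \int[mu]_x ((1 + e)%:E * (normal_pdf 0 sigma' x)%:E).
    rewrite ge0_integralZl ?lee_fin ?(ltW e1) //; first exact: mphi.
    by move=> x _; rewrite lee_fin.
  have E3 : \int[mu]_x (t%:E * ((x ^+ 2)%:E * (normal_pdf 0 sigma x)%:E)) +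
      \int[mu]_x (normal_pdf 0 sigma x)%:E =
      \int[mu]_x (t%:E * ((x ^+ 2)%:E * (normal_pdf 0 sigma x)%:E) + (normal_pdf 0 sigma x)%:E).
    have m1 : measurable_fun setT (fun x => (normal_pdf 0 sigma x)%:E) := mphi sigma.
    have p1 x : [set: R] x -> 0 <= t%:E * ((x ^+ 2)%:E * (normal_pdf 0 sigma x)%:E).
      by move=> _; rewrite -!EFinM lee_fin.
    have p2 x : [set: R] x -> 0 <= (normal_pdf 0 sigma x)%:E by rewrite lee_fin.
    exact: (esym (ge0_integralD mu measurableT p1 mtI p2 m1)).
  rewrite E1 E2 E3.
  apply: ge0_le_integral => //.
  - by move=> x _; rewrite -!EFinM -EFinD lee_fin addr_ge0.
  - by apply: emeasurable_funD => //; exact: mphi.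
  - by apply: emeasurable_funM => //; exact: mphi.
  move=> x _; rewrite -!EFinM -EFinD lee_fin -pE mulrA -[X in (_ + X)%R]mul1r -mulrDl.
  by rewrite ler_wpM2r // addrC expR_ge1Dx.
case: I => [I| |]; [|by rewrite gt0_muley ?lte_fin // addye|by rewrite leNye].
rewrite -EFinM -EFinD !lee_fin addrC lerD2l => tI.
have -> : (sigma' ^+ 2 = sigma ^+ 2 * (1 + e) ^+ 2)%R by rewrite exprMn.
rewrite -(ler_pM2l t0) (le_trans tI) //.
have -> : (t * (sigma ^+ 2 * (1 + e) ^+ 2) = e + e ^+ 2 / 2)%R.
  by rewrite /t /sigma'; field; rewrite s0 gt_eqF.
by rewrite lerDl divr_ge0 // sqr_ge0.
Qed.
End GaussianMoment.

Section MatrixExpectation.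
Context {R : realType} d (T : measurableType d) (P : probability T R).
Local Notation integ f := (P.-integrable setT (EFin \o f)).

Lemma integrable_fsum (I : finType) (f : I -> T -> R) :
  (forall i, integ (f i)) -> integ (fun w => \sum_i f i w) /\
  (\int[P]_w (\sum_i f i w))%R = \sum_i (\int[P]_w f i w)%R.
Proof.
move=> fi; elim: (index_enum I) => [|i s [h e]].
  split; first by apply: eq_integrable (integrable0 _ _) => // w _ /=; rewrite big_nil.
  by rewrite big_nil; under eq_Rintegral do rewrite big_nil; rewrite Rintegral_cst // mul0r.
split.
  apply: eq_integrable (integrableD measurableT (fi i) h) => // w _ /=.
  by rewrite big_cons EFinD.
under eq_Rintegral do rewrite big_cons.
by rewrite big_cons -e -RintegralD.
Qed.

Definition Emx p q (A : T -> 'M[R]_(p, q)) : 'M[R]_(p, q) :=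
  \matrix_(i, j) (\int[P]_w A w i j)%R.

Lemma integrable_mxtrace p q k (A : T -> 'M[R]_(p, q)) (B : 'M[R]_(k, p)) (D : 'M[R]_(q, k)) :
  (forall i j, integ (fun w => A w i j)) -> integ (fun w => \tr (B *m A w *m D)) /\
  (\int[P]_w \tr (B *m A w *m D))%R = \tr (B *m Emx A *m D).
Proof.
move=> Ai.
have trE (M : 'M[R]_(p, q)) : \tr (B *m M *m D) = \sum_i \sum_j (D *m B) j i * M i j.
  rewrite -mulmxA mxtrace_mulC -mulmxA; apply: eq_bigr => i _.
  by rewrite mxE; apply: eq_bigr => j _; rewrite mulrC.
have hij i j : integ (fun w => (D *m B) j i * A w i j).
  by apply: eq_integrable (integrableZl measurableT ((D *m B) j i) (Ai i j)).
have hi i := integrable_fsum (hij i).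
have [h e] := integrable_fsum (fun i => (hi i).1).
have -> : (fun w => \tr (B *m A w *m D)) = fun w => \sum_i \sum_j (D *m B) j i * A w i j.
  by apply/funext => w; rewrite trE.
split=> //; rewrite e trE; apply: eq_bigr => i _; rewrite (hi i).2; apply: eq_bigr => j _.
by rewrite RintegralZl // [Emx A i j]mxE.
Qed.
End MatrixExpectation.

Section IidMoments.
Context {R : realType} (v : R).
Hypothesis v0 : 0 < v.
Context d (T : measurableType d) (P : probability T R) (p q : nat) (M : T -> 'M[R]_(p, q)).
Hypothesis iM : iid_gaussian P M v.
Local Notation integ f := (P.-integrable setT (EFin \o f)).
Local Notation gam := (normal_prob 0 (Num.sqrt v)).

Lemma iid_entry_sqr i j :
  (\int[P]_w (M w i j ^+ 2)%:E = \int[gam]_x (x ^+ 2)%:E)%E.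
Proof.
have [mM gM _] := iM.
have m1 : measurable_fun setT ((fun w => M w i j) : T -> measurableTypeR R) := mM i j.
have m2 : measurable_fun setT (fun x : measurableTypeR R => (x ^+ 2)%:E).
  by apply/measurable_EFinP; exact: exprn_measurable.
rewrite -[LHS](@ge0_integral_pushforward _ _ _ _ _ _ m1 P setT _ measurableT m2); last first.
  by move=> y _; rewrite lee_fin sqr_ge0.
by apply: eq_measure_integral => A mA _; exact: gM.
Qed.

Lemma second_moment_ge0 : (0 <= \int[gam]_x (x ^+ 2)%:E)%E.
Proof. by apply: integral_ge0 => x _; rewrite lee_fin sqr_ge0. Qed.

Lemma second_moment_le : (\int[gam]_x (x ^+ 2)%:E <= v%:E)%E.
Proof.
have s0 : 0 < Num.sqrt v by rewrite sqrtr_gt0.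
by have := normal_second_moment_le s0; rewrite sqr_sqrtr // ltW.
Qed.

Lemma integrable_entry_sqr i j : integ (fun w => M w i j ^+ 2).
Proof.
have [mM _ _] := iM; apply/integrableP; split.
  by apply/measurable_EFinP; exact: measurable_funX.
under eq_integral do rewrite /= ger0_norm ?sqr_ge0 //.
by rewrite iid_entry_sqr (le_lt_trans second_moment_le) // ltry.
Qed.

Lemma integrable_entryM i j k l : integ (fun w => M w i j * M w k l).
Proof.
have [mM _ _] := iM.
apply: (le_integrable measurableT _ _ (integrableD measurableT (integrable_entry_sqr i j) (integrable_entry_sqr k l))).
  by apply/measurable_EFinP; exact: measurable_funM.
move=> w _ /=; rewrite lee_fin normrM (ger0_norm (addr_ge0 (sqr_ge0 _) (sqr_ge0 _))).
rewrite -(real_normK (num_real (M w i j))) -(real_normK (num_real (M w k l))).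
by have := normr_ge0 (M w i j); have := normr_ge0 (M w k l); nra.
Qed.

Lemma integrable_entry i j : integ (fun w => M w i j).
Proof.
have [mM _ _] := iM.
have i1 : integ (fun _ : T => 1) by apply/finite_measure_integrable_cst.
apply: (le_integrable measurableT _ _ (integrableD measurableT i1 (integrable_entry_sqr i j))).
  exact/measurable_EFinP.
move=> w _ /=; rewrite lee_fin (ger0_norm (addr_ge0 ler01 (sqr_ge0 _))).
rewrite -(real_normK (num_real (M w i j))).
by have := normr_ge0 (M w i j); nra.
Qed.

Lemma integrable_bounded_entry (f : T -> R) i j : measurable_fun setT f ->
  (forall w, `|f w| <= 1) -> integ (fun w => f w * M w i j).
Proof.
move=> mf f1; have [mM _ _] := iM.
apply: (le_integrable measurableT _ _ (integrable_entry i j)).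
  by apply/measurable_EFinP; exact: measurable_funM.
by move=> w _; rewrite lee_fin normrM ler_piMl.
Qed.

(** Flipping a row preserves the law, so the expectation equals its own negative. *)
Lemma iid_antisymmetric b (f : mxB R p q -> R) : measurable_fun setT f ->
  integ (fun w => f (M w)) -> (forall N, f (flip R b *m N) = - f N) ->
  (\int[P]_w f (M w))%R = 0.
Proof.
move=> mf fi fN; have v00 : v != 0 by rewrite gt_eqF.
have iF := iid_flip b v00 (ltW v0) iM.
have e : (\int[P]_w f (M w))%R = - (\int[P]_w f (M w))%R.
  rewrite {1}/Rintegral (iid_integral iM iF mf) -mulN1r -RintegralZl //.
  by congr fine; apply: eq_integral => w _; rewrite fN mulN1r.
by apply/eqP; rewrite -[_ == 0](@mulrn_eq0 _ _ 2) mulr2n {2}e subrr.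
Qed.
End IidMoments.

Section CrossMoments.
Context {R : realType} (v : R).
Hypothesis v0 : 0 < v.
Context d0 (T : measurableType d0) (P : probability T R) (p q : nat) (M : T -> 'M[R]_(p, q)).
Hypothesis iM : iid_gaussian P M v.
Local Notation integ f := (P.-integrable setT (EFin \o f)).
Local Notation gam := (normal_prob 0 (Num.sqrt v)).

Lemma integrable_gram i k : integ (fun w => (M w *m (M w)^T) i k).
Proof.
have [h _] := integrable_fsum (fun j => integrable_entryM v0 iM i j k j).
by apply: eq_integrable h => // w _ /=; rewrite mxE; congr EFin; apply: eq_bigr => j _; rewrite mxE.
Qed.

Lemma Emx_gram :
  Emx P (fun w => M w *m (M w)^T) = (q%:R * fine (\int[gam]_x (x ^+ 2)%:E)%E)%:M.
Proof.
apply/matrixP => i k; rewrite mxE [RHS]mxE.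
have [->|ik] := eqVneq i k; last first.
  rewrite mulr0n; apply: (iid_antisymmetric v0 iM (b := k) (f := fun N => (N *m N^T) i k)) => [||N].
  - apply: measurable_mulmx; first exact: measurable_coord.
    by apply: measurable_trmx; exact: measurable_coord.
  - exact: integrable_gram.
  rewrite !mxE -sumrN; apply: eq_bigr => j _.
  by rewrite ![_^T j k]mxE !flip_mulE (negbTE ik) eqxx expr0 expr1 mul1r mulN1r mulrN.
have [_ e] := integrable_fsum (fun j => integrable_entryM v0 iM k j k j).
transitivity (\int[P]_w (\sum_j M w k j * M w k j))%R.
  by apply: eq_Rintegral => w _; rewrite mxE; apply: eq_bigr => j _; rewrite mxE.
rewrite e mulr1n -[in RHS](card_ord q) mulr_natl -sumr_const; apply: eq_bigr => j _.
by rewrite /Rintegral -(iid_entry_sqr iM k j).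
Qed.

Context (d : nat) (h : 'I_d -> 'I_p).
Hypothesis hI : injective h.

Definition rowsel (N : 'M[R]_(p, q)) : 'M[R]_(d, q) := \matrix_(i, j) N (h i) j.
Let f i k (N : 'M[R]_(p, q)) := (polar_ns (rowsel N) *m N^T) i k.

Let mf i k : measurable_fun setT (f i k : mxB R p q -> R).
Proof.
apply: measurable_mulmx; last by apply: measurable_trmx; exact: measurable_coord.
by apply: measurable_polar_ns => a b; under eq_fun do rewrite mxE; exact: measurable_coord.
Qed.

Lemma integrable_polar_cross i k : integ (fun w => (polar_ns (rowsel (M w)) *m (M w)^T) i k).
Proof.
have [mM _ _] := iM.
have hj j : integ (fun w => polar_ns (rowsel (M w)) i j * M w k j).
  apply: (integrable_bounded_entry v0 iM) => [|w]; last exact: polar_ns_le1.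
  by apply: measurable_polar_ns => a b; under eq_fun do rewrite mxE; exact: mM.
have [H _] := integrable_fsum hj.
by apply: eq_integrable H => // w _ /=; rewrite mxE; congr EFin; apply: eq_bigr => j _; rewrite [(M w)^T _ _]mxE.
Qed.

(* Sign changes of single rows kill the off-diagonal entries, and transpositions of
   selected rows equate the diagonal ones. *)
Lemma Emx_polar_cross : (0 < d)%N ->
  Emx P (fun w => polar_ns (rowsel (M w)) *m (M w)^T) =
  (\int[P]_w (d%:R^-1 * \tr (polar_ns (rowsel (M w)) *m (rowsel (M w))^T)))%R *:
    \matrix_(i, k) (k == h i)%:R.
Proof.
move=> dp; have fi i k := integrable_polar_cross i k.
have off i k : k != h i -> (\int[P]_w f i k (M w))%R = 0.
  move=> khi; apply: (iid_antisymmetric v0 iM (b := k) (f := f i k)) => [||N]; [exact: mf|exact: fi|rewrite /f].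
  (* Flipping row [k] of [N] acts on the selected rows through [D], and leaves row [i] of the polar
     factor unchanged because k != h i; only the factor N_kj changes sign. *)
  pose D : 'M[R]_d := diag_mx (\row_a (-1) ^+ (h a == k)).
  have DD : D^T *m D = 1%:M.
    rewrite tr_diag_mx; apply/matrixP => a b; rewrite mul_diag_mx !mxE.
    case: (eqVneq a b) => [_|_] /=; last by rewrite !mulr0n mulr0.
    by rewrite !mulr1n -expr2 sqrr_sign.
  have -> : rowsel (flip R k *m N) = D *m rowsel N.
    by apply/matrixP => a b; rewrite [LHS]mxE flip_mulE mul_diag_mx !mxE.
  rewrite (polar_ns_mull _ DD) [LHS]mxE.
  transitivity (- \sum_j polar_ns (rowsel N) i j * N^T j k); last by rewrite [in RHS]mxE.
  rewrite -sumrN; apply: eq_bigr => j _; move: (polar_ns _) => Y.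
  rewrite [(flip R k *m N)^T j k]mxE [N^T j k]mxE flip_mulE eqxx expr1 mulN1r mulrN.
  by rewrite mul_diag_mx !mxE eq_sym (negbTE khi) expr0 mul1r.
have diag i i' : (\int[P]_w f i (h i) (M w))%R = (\int[P]_w f i' (h i') (M w))%R.
  pose s := tperm (h i) (h i').
  have iS := iid_rowsel (@perm_inj _ s) iM.
  rewrite {1}/Rintegral (iid_integral iM iS (mf i (h i))) /Rintegral; congr fine.
  apply: eq_integral => w _; congr EFin; rewrite /f.
  have -> : rowsel (\matrix_(a, j) M w (s a) j) = perm_mx (tperm i i') *m rowsel (M w).
    rewrite -row_permE; apply/matrixP => a j; rewrite !mxE; congr (M w _ _).
    rewrite /s; case: (tpermP i i' a) => [->|->|ai ai']; rewrite ?tpermL ?tpermR //.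
    by rewrite tpermD // (inj_eq hI) eq_sym; apply/eqP.
  rewrite polar_ns_mull; last by rewrite tr_perm_mx -perm_mxM mulVg perm_mx1.
  rewrite -row_permE mxE [RHS]mxE; apply: eq_bigr => j _.
  by rewrite !mxE /s !tpermL.
have dn0 : d%:R != 0 :> R by rewrite pnatr_eq0 -lt0n.
have trE : (\int[P]_w (d%:R^-1 * \tr (polar_ns (rowsel (M w)) *m (rowsel (M w))^T)))%R =
    d%:R^-1 * \sum_i (\int[P]_w f i (h i) (M w))%R.
  have [H e] := integrable_fsum (fun i => fi i (h i)).
  rewrite -[X in _ = _ * X]e -RintegralZl //; apply: eq_Rintegral => w _; congr (_ * _).
  by apply: eq_bigr => i _; rewrite /f !mxE; apply: eq_bigr => j _; rewrite !mxE.
apply/matrixP => i k; rewrite mxE [RHS]mxE [X in _ = _ * X]mxE.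
have [->|khi] := eqVneq k (h i); last by rewrite mulr0; exact: off.
rewrite mulr1 trE (eq_bigr (fun=> (\int[P]_w f i (h i) (M w))%R)) => [|a _]; last exact: diag.
by rewrite sumr_const card_ord -[X in _ * X]mulr_natl mulKf.
Qed.
End CrossMoments.

(** * Comparison of integrals and the cross moment for a general feasible X *)

Section Assembly.
Context {R : realType} d0 (T : measurableType d0) (P : probability T R).
Local Notation integ f := (P.-integrable setT (EFin \o f)).

Import HBNNSimple.

(* The integral of a nonnegative function is a supremum over the simple functions below it. *)
Lemma ge0_le_integral_nonmeasurable (f g : T -> \bar R) :
  (forall w, 0 <= f w)%E -> (forall w, f w <= g w)%E ->
  (\int[P]_w f w <= \int[P]_w g w)%E.
Proof.
move=> f0 fg; have g0 w : (0 <= g w)%E by exact: le_trans (fg w).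
rewrite !ge0_integralTE //; apply: ereal_sup_le => _ [h hf <-].
by exists h => // w; exact: le_trans (hf w) (fg w).
Qed.

(** The product packs finitely many null events into one measurable null event. *)
Lemma prob_prod_eq0 (I : finType) (f : I -> T -> R) :
  (forall i, measurable_fun setT (f i)) -> (forall i, P [set w | f i w = 0] = 0%E) ->
  measurable [set w | \prod_i f i w = 0] /\ P [set w | \prod_i f i w = 0] = 0%E.
Proof.
move=> mf f0.
have m0 (g : T -> R) : measurable_fun setT g -> measurable [set w | g w = 0].
  by move=> mg; rewrite -[X in measurable X]setTI; exact: (mg measurableT _ (measurable_set1 0)).
have mp s : measurable_fun setT (fun w => \prod_(i <- s) f i w).
  by apply: measurable_prod => i _; exact: mf.
split; first exact: m0 (mp _).
elim: (index_enum I) => [|i s IHs].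
  rewrite (_ : [set _ | _] = set0) ?measure0 //; apply/seteqP; split => w //=.
  by rewrite big_nil => /eqP; rewrite oner_eq0.
rewrite (_ : [set _ | _] = [set w | f i w = 0] `|` [set w | \prod_(j <- s) f j w = 0]).
  have mi := m0 _ (mf i); have ms := m0 _ (mp s).
  apply/(negligibleP P (measurableU _ _ mi ms)).
  by apply: negligibleU; [apply/(negligibleP P mi); exact: f0|apply/(negligibleP P ms); exact: IHs].
apply/seteqP; split => w /=; rewrite big_cons.
  by move/eqP; rewrite mulf_eq0 => /orP[] /eqP; [left|right].
by case=> ->; rewrite ?mul0r ?mulr0.
Qed.

(** The tangent bound may be negative while the objective is not; its positive part makes the
    nonnegative comparison applicable. *)
Lemma le_Rintegral_funrpos (f : T -> R) : integ f ->
  ((\int[P]_w f w)%R%:E <= \int[P]_w (Num.max (f w) 0)%:E)%E.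
Proof.
move=> fi; rewrite /Rintegral fineK; last exact: (integrable_fin_num measurableT fi).
rewrite integralE; set A := integral _ _ _; set B := integral _ _ _.
have -> : (\int[P]_w (Num.max (f w) 0)%:E)%E = A.
  by apply: eq_integral => w _; rewrite funeposE EFin_max.
rewrite -[leRHS]adde0 leeD2l // oppe_le0.
by apply: integral_ge0 => w _; exact: funeneg_ge0.
Qed.

Lemma integrable_mulmxr p q k (A : T -> 'M[R]_(p, q)) (D : 'M[R]_(q, k)) :
  (forall i j, integ (fun w => A w i j)) ->
  (forall i j, integ (fun w => (A w *m D) i j)) /\ Emx P (fun w => A w *m D) = Emx P A *m D.
Proof.
move=> Ai; have hij i j l : integ (fun w => D l j * A w i l).
  by apply: eq_integrable (integrableZl measurableT (D l j) (Ai i l)).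
have E i j : (fun w => (A w *m D) i j) = fun w => \sum_l D l j * A w i l.
  by apply/funext => w; rewrite mxE; apply: eq_bigr => l _; rewrite mulrC.
split=> [i j|]; first by rewrite E; exact: (integrable_fsum (hij i j)).1.
apply/matrixP => i j; rewrite mxE E (integrable_fsum (hij i j)).2 [RHS]mxE.
by apply: eq_bigr => l _; rewrite RintegralZl // [Emx P A i l]mxE mulrC.
Qed.

Lemma integrable_obj_sum n p q k (B : 'I_n -> 'I_n -> 'M[R]_(k, p))
    (A : 'I_n -> T -> 'M[R]_(p, q)) (D : 'I_n -> 'M[R]_(q, k)) :
  (forall i a b, integ (fun w => A i w a b)) ->
  integ (fun w => \sum_i \sum_j \tr (B i j *m A i w *m D j)) /\
  (\int[P]_w (\sum_i \sum_j \tr (B i j *m A i w *m D j)))%R =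
  \sum_i \sum_j \tr (B i j *m Emx P (A i) *m D j).
Proof.
move=> Ai; have t i j := integrable_mxtrace (B i j) (D j) (Ai i).
have s i := integrable_fsum (fun j => (t i j).1).
have [h e] := integrable_fsum (fun i => (s i).1).
split=> //; rewrite e; apply: eq_bigr => i _; rewrite (s i).2; apply: eq_bigr => j _.
by rewrite (t i j).2.
Qed.

Variable v : R.
Hypothesis v0 : 0 < v.

(** Through [tr_polar_ns], alpha becomes the normalized trace that appears as the coefficient in
    [Emx_polar_cross]. *)
Lemma alphaE_fin d r (G : T -> 'M[R]_(d, r)) : iid_gaussian P G v ->
  alphaE P G = (\int[P]_w (d%:R^-1 * \tr (polar_ns (G w) *m (G w)^T)))%R%:E.
Proof.
move=> iG; have fi i := integrable_polar_cross v0 iG id i i.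
have [h _] := integrable_fsum fi.
have trE w : \tr (polar_ns (G w) *m (G w)^T) =
    \sum_i (polar_ns (rowsel id (G w)) *m (G w)^T) i i.
  by congr (\tr (polar_ns _ *m _)); apply/matrixP => a b; rewrite mxE.
rewrite /Rintegral fineK.
  by apply: eq_integral => w _; rewrite tr_polar_ns.
apply: (integrable_fin_num measurableT).
have h' : integ (fun w => \tr (polar_ns (G w) *m (G w)^T)).
  by apply: eq_integrable h => // w _ /=; rewrite trE.
by apply: eq_integrable (integrableZl measurableT d%:R^-1 h').
Qed.

Lemma iid_gram_det_neq0_pos d r (G : T -> 'M[R]_(d, r)) : (0 < d)%N -> (d <= r)%N ->
  iid_gaussian P G v -> P [set w | \det (G w *m (G w)^T) = 0] = 0%E.
Proof.
by case: d r G => [|d] [|r] // G _ dr iG; apply: iid_gram_det_neq0 iG.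
Qed.

(* [X = S H] with [S] selecting the first rows and [H] orthogonal preserving the law. *)
Lemma stiefel_mul_iid d N r (X : 'M[R]_(d, N)) (M : T -> 'M[R]_(N, r)) :
  (d <= N)%N -> stiefel X -> iid_gaussian P M v -> exists H (h : 'I_d -> 'I_N),
  [/\ injective h, H^T *m H = 1%:M, iid_gaussian P (fun w => H *m M w) v,
      X = (\matrix_(i, k) (k == h i)%:R) *m H &
      forall w, X *m M w = rowsel h (H *m M w)].
Proof.
move=> dN sX iM.
(* Quantifying over every Gaussian [M'] is what makes [K] closed under products. *)
pose K (H : 'M[R]_N) := forall M' : T -> 'M[R]_(N, r),
  iid_gaussian P M' v -> iid_gaussian P (fun w => H *m M' w) v.
have K1 : K 1%:M by move=> M'; under eq_fun do rewrite mul1mx.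
have KM H1 H2 : K H1 -> K H2 -> K (H1 *m H2).
  by move=> k1 k2 M' iM'; under eq_fun do rewrite -mulmxA; apply: k1; exact: k2.
have Kg a b c s : a != b -> c ^+ 2 + s ^+ 2 = 1 -> c != -1 -> K (givens a b c s).
  by move=> ab cs cN M' iM'; exact: iid_givens.
have Kf b : K (flip R b) by move=> M' iM'; apply: iid_flip => //; rewrite ?gt_eqF // ltW.
have [H [KH oH XE]] := givens_reduction K1 KM Kg Kf dN sX.
exists H, (widen_ord dN); split=> //.
- by move=> a b /(congr1 val) /= e; apply: val_inj.
- exact: KH.
move=> w; rewrite {1}XE -mulmxA; apply/matrixP => a j; rewrite [LHS]mxE [RHS]mxE.
by under eq_bigr do rewrite mxE; rewrite sum_delta.
Qed.

(** With R' = H R one has R^T = R'^T H, so the moment for R', namely alpha S, is multiplied on the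
    right by H and gives alpha S H = alpha X. [G] enters only through its law. *)
Lemma Emx_polar_stiefel d N r (X : 'M[R]_(d, N)) (M : T -> 'M[R]_(N, r)) (G : T -> 'M[R]_(d, r)) :
  (0 < d)%N -> (d <= N)%N -> stiefel X -> iid_gaussian P M v -> iid_gaussian P G v ->
  (forall i k, integ (fun w => (polar_ns (X *m M w) *m (M w)^T) i k)) /\
  Emx P (fun w => polar_ns (X *m M w) *m (M w)^T) = fine (alphaE P G) *: X.
Proof.
move=> dp dN sX iM iG; have [H [h [hI oH iHM XE XM]]] := stiefel_mul_iid dN sX iM.
have E : (fun w => polar_ns (X *m M w) *m (M w)^T) =
    fun w => (polar_ns (rowsel h (H *m M w)) *m (H *m M w)^T) *m H.
  by apply/funext => w; rewrite XM trmx_mul -!mulmxA oH mulmx1.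
have fi i k := integrable_polar_cross v0 iHM h i k.
have [h1 h2] := integrable_mulmxr H fi.
split=> [i k|].
  by have := h1 i k; rewrite -[(fun w => _ i k)]/(fun w => (fun w => _ *m _) w i k); rewrite -E.
rewrite E h2 (Emx_polar_cross v0 iHM hI dp) -scalemxAl -XE; congr (_ *: _).
rewrite (alphaE_fin iG) /= /Rintegral; congr fine.
have iK : iid_gaussian P (fun w => rowsel h (H *m M w)) v by exact: (iid_rowsel hI iHM).
apply: (iid_integral iK iG (f := fun Y => d%:R^-1 * \tr (polar_ns Y *m Y^T))).
apply: measurable_funM => //; apply: measurable_sum => a; apply: measurable_mulmx.
  by apply: measurable_polar_ns; exact: measurable_coord.
by apply: measurable_trmx; exact: measurable_coord.
Qed.
End Assembly.
Theorem theorem4 (R : realType) (n d r : nat)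
    (dsp : measure_display) (T : measurableType dsp) (P : probability T R)
    (C : 'M[R]_(n * d)) (X : 'I_n -> 'M[R]_(d, n * d))
    (Rm : T -> 'M[R]_(n * d, r)) (G : T -> 'M[R]_(d, r)) :
  (1 <= d)%N -> (d <= r)%N -> (1 <= n)%N ->
  psd C ->
  optimal C X ->
  iid_gaussian P Rm (r%:R^-1) ->
  iid_gaussian P G (r%:R^-1) ->
  (alphaE P G * alphaE P G *
     ereal_sup [set (obj C O)%:E | O in
                  [set O : 'I_n -> 'M[R]_(d, r) | forall i, stiefel (O i)]]
   <= \int[P]_w (obj C (fun i => polar (X i *m Rm w)))%:E)%E.
Proof.
move=> d1 dr n1 psdC optX iR iG.
have r0 : (r%:R : R) != 0 by rewrite pnatr_eq0 -lt0n (leq_trans d1 dr).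
have v0 : 0 < r%:R^-1 :> R by rewrite invr_gt0 lt_neqAle eq_sym r0 ler0n.
have dN : (d <= n * d)%N by rewrite -{1}(mul1n d) leq_mul2r n1 orbT.
have [sX _] := optX.
set a := fine (alphaE P G).
have aE : alphaE P G = a%:E by rewrite /a (alphaE_fin v0 iG).
pose Z i w := polar_ns (X i *m Rm w).
have cross i := Emx_polar_stiefel v0 d1 dN (sX i) iR iG.
pose o2 w := obj2 C (Z^~ w) (fun j => X j *m Rm w).
pose oR w := obj C (fun j => X j *m Rm w).
have [int_o2 Eo2] : P.-integrable setT (EFin \o o2) /\ (\int[P]_w o2 w)%R = a * obj C X.
  have -> : o2 = fun w => \sum_i \sum_j
      \tr ((block C i j)^T *m (Z i w *m (Rm w)^T) *m (X j)^T).
    by apply/funext => w; apply: eq_bigr => i _; apply: eq_bigr => j _; rewrite trmx_mul !mulmxA.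
  have [h ->] := integrable_obj_sum (fun i j => (block C i j)^T) (fun j => (X j)^T) (fun i => (cross i).1).
  split=> //; rewrite mulr_sumr; apply: eq_bigr => i _; rewrite mulr_sumr; apply: eq_bigr => j _.
  by rewrite (cross i).2 -scalemxAr -scalemxAl mxtraceZ.
pose m2 : R := fine (\int[normal_prob 0 (Num.sqrt r%:R^-1)]_x (x ^+ 2)%:E)%E.
have [int_oR EoR] : P.-integrable setT (EFin \o oR) /\ (\int[P]_w oR w)%R = r%:R * m2 * obj C X.
  have -> : oR = fun w => \sum_i \sum_j
      \tr (((block C i j)^T *m X i) *m (Rm w *m (Rm w)^T) *m (X j)^T).
    by apply/funext => w; apply: eq_bigr => i _; apply: eq_bigr => j _; rewrite trmx_mul !mulmxA.
  have [h ->] := integrable_obj_sum (A := fun _ w => Rm w *m (Rm w)^T)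
    (fun i j => (block C i j)^T *m X i) (fun j => (X j)^T) (fun _ => integrable_gram v0 iR).
  split=> //; rewrite mulr_sumr; apply: eq_bigr => i _; rewrite mulr_sumr; apply: eq_bigr => j _.
  by rewrite (Emx_gram v0 iR) mul_mx_scalar -scalemxAl mxtraceZ.
have m2_le : r%:R * m2 <= 1.
  apply: (@le_trans _ _ (r%:R * r%:R^-1)); last by rewrite mulfV.
  rewrite ler_wpM2l ?ler0n // -lee_fin fineK ?second_moment_le //.
  rewrite ge0_fin_numE ?second_moment_ge0 //.
  by rewrite (le_lt_trans (second_moment_le v0)) // ltry.
have X0 : 0 <= obj C X := obj_ge0 X psdC.
(* The tangent bound [obj_tangent] with c = alpha. *)
pose h w := 2 * a * o2 w - a ^+ 2 * oR w.
have int1 : P.-integrable setT (EFin \o (fun w => 2 * a * o2 w)).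
  by apply: eq_integrable (integrableZl measurableT (2 * a) int_o2).
have int2 : P.-integrable setT (EFin \o (fun w => a ^+ 2 * oR w)).
  by apply: eq_integrable (integrableZl measurableT (a ^+ 2) int_oR).
have hi : P.-integrable setT (EFin \o h).
  by apply: eq_integrable (integrableB measurableT int1 int2).
have hE : a ^+ 2 * obj C X <= (\int[P]_w h w)%R.
  rewrite /h RintegralB // !RintegralZl // Eo2 EoR.
  have -> : 2 * a * (a * obj C X) - a ^+ 2 * (r%:R * m2 * obj C X) =
    a ^+ 2 * obj C X * (2 - r%:R * m2) by ring.
  apply: ler_peMr; first by rewrite mulr_ge0 ?sqr_ge0.
  by move: (r%:R * m2) m2_le => t t1; lra.
have supE : (alphaE P G * alphaE P G *
     ereal_sup [set (obj C O)%:E | O in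
                  [set O : 'I_n -> 'M[R]_(d, r) | forall i, stiefel (O i)]]
   <= (a ^+ 2 * obj C X)%:E)%E.
  rewrite aE -EFinM -expr2 [leRHS]EFinM; apply: lee_wpmul2l; first by rewrite lee_fin sqr_ge0.
  by apply: ge_ereal_sup => _ [V sV <-]; rewrite lee_fin; exact: sup_obj_le optX sV.
apply: (le_trans supE); apply: (@le_trans _ _ (\int[P]_w h w)%R%:E); first by rewrite lee_fin.
apply: (le_trans (le_Rintegral_funrpos hi)).
have rank_ae i : P [set w | \det (X i *m Rm w *m (X i *m Rm w)^T) = 0] = 0%E.
  have [H [k [kI oH iHR XE XM]]] := stiefel_mul_iid v0 dN (sX i) iR.
  have := iid_gram_det_neq0_pos d1 dr (iid_rowsel kI iHR).
  by congr (P _ = _); apply/seteqP; split => w /=; rewrite XM.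
have [mR _ _] := iR.
have mdet i : measurable_fun setT (fun w => \det (X i *m Rm w *m (X i *m Rm w)^T)).
  have mXR : forall a0 b, measurable_fun setT (fun w => (X i *m Rm w) a0 b).
    by apply: measurable_mulmx => // a0 b; exact: measurable_cst.
  by apply: measurable_det; apply: measurable_mulmx => //; exact: measurable_trmx.
(* Off this null set every [X i *m Rm w] has full rank, so [polar] and [polar_ns] coincide for all
   [i] at once. *)
have [mN PN] := prob_prod_eq0 mdet rank_ae.
set N := [set w | _] in mN PN.
have mh : measurable_fun setT (fun w => (Num.max (h w) 0)%:E).
  have /integrableP[/measurable_EFinP mh _] := hi.
  by apply/measurable_EFinP; exact: measurable_maxr.
rewrite (ge0_negligible_integral mN measurableT mh _ PN); last first.
  by move=> w _; rewrite lee_fin le_max lexx orbT.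
(* On the null set the left function is now 0, and the objective is nonnegative whatever [polar]
   returns there. *)
rewrite integral_mkcond; apply: ge0_le_integral_nonmeasurable => w.
  by rewrite patchE; case: ifP => // _; rewrite lee_fin le_max lexx orbT.
rewrite patchE; case: ifPn => [|_]; last by rewrite lee_fin obj_ge0.
move=> /set_mem[_ /= /eqP/prodf_neq0 full]; rewrite lee_fin ge_max obj_ge0 // andbT.
have -> : (fun i => polar (X i *m Rm w)) = Z^~ w.
  by apply/funext => i; exact: (polarE (full i isT)).2.
exact: obj_tangent.
Qed.
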